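(* Let $0<\varepsilon\le \frac12$. Let $J=(X,k,\mathcal R)$ be any instance of the constrained binary $k$-means problem and let $B$ be an $\alpha$-approximate solution for the binary $k$-means instance $(X,k)$. Then the algorithm $\mathtt{GoodCenters}(J,B,\varepsilon)$ returns a tuple of centers $D$ satisfying $\mathcal R$ such that \[ \mathbf{Pr}\big[\Phi(D,X)\le (1+\varepsilon)\cdot OPT\big]\ge \tfrac34 . \] The running time of the algorithm is $O\!\left(nd\cdot(\log n)^k\cdot 2^{\tilde O(k^2/\varepsilon^2)}\right)$.
   Context: For $x,y\in\{0,1\}^d$, $\mathcal H(x,y)$ is the Hamming distance (equal to $\|x-y\|_2^2$). An instance of the constrained binary $k$-means problem is $J=(X,k,\mathcal R)$, where $X\subseteq\{0,1\}^d$ is a set of $n$ points, $k$ is a positive integer, and $\mathcal R=\{R_1,\dots,R_d\}$ with each $R_i\subseteq\{0,1\}^k$ a $k$-ary relation. A tuple $(c_1,\dots,c_k)$ of points of $\{0,1\}^d$ satisfies $\mathcal R$ if $(c_1[i],\dots,c_k[i])\in R_i$ for every $i=1,\dots,d$, where $c[i]$ is the $i$-th coordinate. For a finite set of centers $C$ and a finite (multi)set $Y$, $\Phi(C,Y)=\sum_{y\in Y}\min_{c\in C}\mathcal H(y,c)$. $OPT$ is the minimum of $\Phi(C,X)$ over tuples $C$ satisfying $\mathcal R$. The binary $k$-means instance $(X,k)$ asks for a set $C\subseteq\{0,1\}^d$ of $k$ centers minimizing $\Phi(C,X)$; its optimum is $OPT^\star$. $B$ is an $\alpha$-approximate solution if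 $B$ is such a set of $k$ centers with $\Phi(B,X)\le\alpha\cdot OPT^\star$. $D^2$-sampling w.r.t. $B$ draws $x\in X$ with probability $\Phi(B,\{x\})/\Phi(B,X)$. Subroutine $\mathtt{best}_{\mathcal R}(J,S_1,\dots,S_k,w_1,\dots,w_k)$ (multisets $S_j\subseteq\{0,1\}^d$, numbers $w_j$): for each coordinate $i\in\{1,\dots,d\}$, let $S_j^{(i,b)}$ be the elements of $S_j$ whose $i$-th bit is $b$, choose $(b_1,\dots,b_k)\in R_i$ minimizing $f_i(b_1,\dots,b_k)=\sum_{j:b_j=1}w_j|S_j^{(i,0)}|+\sum_{j:b_j=0}w_j|S_j^{(i,1)}|$, and set $(c_1[i],\dots,c_k[i])=(b_1,\dots,b_k)$; return $(c_1,\dots,c_k)$. Algorithm $\mathtt{GoodCenters}(J,B,\varepsilon)$, with parameters $\tau=\Theta(\frac{k}{\varepsilon^2}\log\frac{k}{\varepsilon})$, $\eta=\Theta(\frac{\tau\alpha k}{\varepsilon^2})$, $\zeta=\Theta(\frac1\varepsilon)$ (suitable hidden constants): set $\mathcal C\leftarrow\emptyset$; repeat $\zeta$ times: sample a multiset $M$ of $\eta k$ points from $X$ independently by $D^2$-sampling w.r.t. $B$; add $\tau k$ copies of each element of $B$ to $M$; for all disjoint sub-multisets $S_1,\dots,S_k$ of $M$ with $|S_i|=\tau$ for all $i$, and for all $w_1,\dots,w_k\in\{(1+\frac\varepsilon2)^t: t=0,1,\dots,\lceil\log_{1+\varepsilon/2}n\rceil\}$, add $\mathtt{best}_{\mathcal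 R}(J,S_1,\dots,S_k,w_1,\dots,w_k)$ to $\mathcal C$. Finally return the center tuple in $\mathcal C$ with least cost $\Phi(\cdot,X)$.
   Formalization: The 3/4 bound is false if optimal clusters may be empty (all weights are ≥ 1); it is proved when some optimal solution has k nonempty clusters, or for every feasible instance with weight 0 added to the weight list. α is a constant in the time bound; D²-sampling is uniform if Φ(B,X)=0. *)

(* Defs.v *)
From HB Require Import structures.
From mathcomp Require Import all_boot all_order all_algebra.
From mathcomp Require Import all_classical all_reals all_analysis.

Set Implicit Arguments.
Unset Strict Implicit.
Unset Printing Implicit Defensive.

Import Order.TTheory GRing.Theory Num.Theory.
Local Open Scope ring_scope.

(** * Constrained binary k-means *)

Definition bpoint (d : nat) := d.-tuple bool.

Definition hamming d (x y : bpoint d) : nat :=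
  (\sum_(i < d) (tnth x i != tnth y i))%N.

(* The unit [d] of the iterated minimum bounds every Hamming distance in
   dimension [d], so for a nonempty [C] this is a genuine minimum. *)
Definition dist_to d (C : {set bpoint d}) (x : bpoint d) : nat :=
  \big[minn/d]_(c in C) hamming x c.

Definition Phi d (C Y : {set bpoint d}) : nat := (\sum_(y in Y) dist_to C y)%N.

Record instance (d k : nat) := Instance {
  pts : {set bpoint d};
  rels : 'I_d -> {set k.-tuple bool} }.

Definition column d k (D : k.-tuple (bpoint d)) (i : 'I_d) : k.-tuple bool :=
  [tuple tnth (tnth D j) i | j < k].

Definition satisfies d k (J : instance d k) (D : k.-tuple (bpoint d)) : bool :=
  [forall i, column D i \in rels J i].

Definition centers d k (D : k.-tuple (bpoint d)) : {set bpoint d} :=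
  [set c in D].

Definition feasible d k (J : instance d k) : Prop := exists D, satisfies J D.

(* The units of the next two minima bound every cost from above, so these are
   the true minima as soon as the index set is nonempty. *)
Definition OPT d k (J : instance d k) : nat :=
  \big[minn/(#|pts J| * d)%N]_(D : k.-tuple (bpoint d) | satisfies J D)
    Phi (centers D) (pts J).

Definition OPTstar d (k : nat) (X : {set bpoint d}) : nat :=
  \big[minn/(#|X| * d)%N]_(C : {set bpoint d} | #|C| == k) Phi C X.

Definition approximate_solution (R : realType) (alpha : R) d (k : nat)
    (X B : {set bpoint d}) : Prop :=
  #|B| = k /\ (Phi B X)%:R <= alpha * (OPTstar k X)%:R.

(* Some optimal tuple admits an optimal assignment of the points to its entries
   that leaves none of the k clusters empty. *)
Definition optimal_clusters_nonempty d k (J : instance d k) : Prop :=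
  exists (D : k.-tuple (bpoint d)) (s : bpoint d -> 'I_k),
    [/\ satisfies J D,
        (\sum_(x in pts J) hamming x (tnth D (s x)))%N = OPT J
      & forall j : 'I_k, exists2 x, x \in pts J & s x = j].

(** * Randomized programs with a running time *)

(* [Step c] spends one time unit.  [Draw w f] continues with [f i], where the
   index i < size w is drawn with probability w_i / \sum w; its cost is
   [size w], that of a linear scan of the cumulated weights. *)
Inductive prog (R A : Type) : Type :=
| Ret of A
| Step of prog R A
| Draw of seq R & (nat -> prog R A).
Arguments Ret {R A} _.
Arguments Step {R A} _.
Arguments Draw {R A} _ _.

Fixpoint bind (R A B : Type) (c : prog R A) (f : A -> prog R B) : prog R B :=
  match c with
  | Ret a => f a
  | Step c' => Step (bind c' f)
  | Draw w g => Draw w (fun i => bind (g i) f)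
  end.

Notation "x <-- c ;; e" := (bind c (fun x => e))
  (at level 61, c at next level, right associativity,
   format "x  <--  c ;;  '//' e").

(* Distinct draws are independent: the weights multiply along a run. *)
Fixpoint prob (R : realType) (A : Type) (E : pred A) (c : prog R A) : R :=
  match c with
  | Ret a => (E a)%:R
  | Step c' => prob E c'
  | Draw w g => \sum_(i < size w) (w`_i / \sum_(v <- w) v) * prob E (g i)
  end.

(* Worst case over all outcomes of the draws. *)
Fixpoint time (R A : Type) (c : prog R A) : nat :=
  match c with
  | Ret _ => 0%N
  | Step c' => (time c').+1
  | Draw w g => (size w + \max_(i < size w) time (g i))%N
  end.

Fixpoint always (R A : Type) (P : A -> Prop) (c : prog R A) : Prop :=
  match c with
  | Ret a => P a
  | Step c' => always P c'
  | Draw w g => forall i, (i < size w)%N -> always P (g i)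
  end.

(** * The algorithm

  Every iteration of a loop costs one unit on top of the cost of its body; a
  [Ret] may only perform a bounded number of operations on numbers (integers
  or reals), bits, array cells and list ends, so that all the remaining work is
  accounted for by loops, recursive calls, draws and explicit [steps].
  Sets given as input are stored as the lists of their elements. *)

Fixpoint foldM (R A B : Type) (f : B -> A -> prog R B) (b : B) (s : seq A) :
    prog R B :=
  if s is x :: s' then Step (b' <-- f b x ;; foldM f b' s') else Ret b.

Definition steps (R A : Type) (t : nat) (c : prog R A) : prog R A :=
  iter t Step c.

Definition argminM (R : realType) (A : Type) (f : A -> prog R R) (s : seq A) :
    prog R (option A) :=
  r <-- foldM (fun (m : option (A * R)) a =>
          v <-- f a ;;
          Ret (if m is Some (a0, v0) then
                 if v < v0 then Some (a, v) else Some (a0, v0)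
               else Some (a, v))) None s ;;
  Ret (omap fst r).

Section Algorithm.
Variable R : realType.
Variables (d k : nat).

Definition hammingM (x y : bpoint d) : prog R nat :=
  foldM (fun h i => Ret (h + (tnth x i != tnth y i))%N) 0%N (enum 'I_d).

Definition dist_toM (C : seq (bpoint d)) (x : bpoint d) : prog R nat :=
  foldM (fun m c => h <-- hammingM x c ;; Ret (minn m h)) d C.

Definition PhiM (C Y : seq (bpoint d)) : prog R nat :=
  foldM (fun s y => m <-- dist_toM C y ;; Ret (s + m)%N) 0%N Y.

(* The weights of D^2-sampling.  When Phi(B,X) = 0 the D^2-distribution is
   undefined, and the uniform distribution on X is used instead. *)
Definition D2weightsM (B X : seq (bpoint d)) : prog R (seq R) :=
  w <-- foldM (fun w x => m <-- dist_toM B x ;; Ret (rcons w m%:R)) [::] X ;;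
  t <-- foldM (fun t v => Ret (t + v)) 0 w ;;
  foldM (fun w' v => Ret (rcons w' (if t == 0 then 1 else v))) [::] w.

Definition sampleM (X : seq (bpoint d)) (w : seq R) (N : nat) :
    prog R (seq (bpoint d)) :=
  foldM (fun M _ =>
           Draw w (fun i => Ret (rcons M (nth (nseq_tuple d false) X i))))
        [::] (iota 0 N).

Definition add_copiesM (t : nat) (B M : seq (bpoint d)) :
    prog R (seq (bpoint d)) :=
  foldM (fun M b => foldM (fun M _ => Ret (rcons M b)) M (iota 0 t)) M B.

(* The list of all pairs (S, M \ S), S a sub-multiset of M of size t. *)
Fixpoint picksM (M : seq (bpoint d)) (t : nat) {struct M} :
    prog R (seq (seq (bpoint d) * seq (bpoint d))) :=
  Step (match t, M with
        | 0, _ => Ret [:: ([::], M)]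
        | _.+1, [::] => Ret [::]
        | t'.+1, x :: M' =>
            a <-- picksM M' t' ;;
            b <-- picksM M' t ;;
            r <-- foldM (fun r p => Ret ((x :: p.1, p.2) :: r)) [::] a ;;
            foldM (fun r p => Ret ((p.1, x :: p.2) :: r)) r b
        end).

(* The list of all (S_1, ..., S_l), S_j disjoint sub-multisets of M of size t. *)
Fixpoint disjointM (t l : nat) (M : seq (bpoint d)) :
    prog R (seq (seq (seq (bpoint d)))) :=
  if l is l'.+1 then
    ps <-- picksM M t ;;
    foldM (fun r p =>
      qs <-- disjointM t l' p.2 ;;
      foldM (fun r q => Ret ((p.1 :: q) :: r)) r qs) [::] ps
  else Ret [:: [::]].

(* The list of all (w_1, ..., w_l) with entries in W. *)
Fixpoint wordsM (l : nat) (W : seq R) : prog R (seq (seq R)) :=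
  if l is l'.+1 then
    us <-- wordsM l' W ;;
    foldM (fun r w => foldM (fun r u => Ret ((w :: u) :: r)) r us) [::] W
  else Ret [:: [::]].

Definition logceil (base : R) (n : nat) : nat :=
  `|(Num.ceil (ln n%:R / ln base))%R|%N.

(* The weights (1 + eps/2)^t, 0 <= t <= ceil(log_(1 + eps/2) n), preceded by the
   weight 0 if [zero] is set.  The positive weights cannot express that a cluster
   is empty, and several empty clusters can outweigh every nonempty one. *)
Definition weightsM (zero : bool) (eps : R) (n : nat) : prog R (seq R) :=
  r <-- foldM (fun (r : seq R * R) _ =>
                 Ret (rcons r.1 r.2, r.2 * (1 + eps / 2)))
              (if zero then [:: 0] else [::], 1)
              (iota 0 (logceil (1 + eps / 2) n).+1) ;;
  Ret r.1.

Variable J : instance d k.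

(* The array of the pairs (w_j |S_j^(i,0)|, w_j |S_j^(i,1)|), j < k. *)
Definition bit_countsM (S : seq (seq (bpoint d))) (w : seq R) (i : 'I_d) :
    prog R (seq (R * R)) :=
  foldM (fun r (j : 'I_k) =>
    n01 <-- foldM (fun (n01 : nat * nat) x =>
              Ret (if tnth x i then (n01.1, n01.2.+1) else (n01.1.+1, n01.2)))
            (0%N, 0%N) (nth [::] S j) ;;
    Ret (rcons r (w`_j * n01.1%:R, w`_j * n01.2%:R))) [::] (enum 'I_k).

(* f_i(b_1, ..., b_k) *)
Definition fM (r : seq (R * R)) (b : k.-tuple bool) : prog R R :=
  foldM (fun s (j : 'I_k) =>
    Ret (s + (if tnth b j then (nth (0, 0) r j).1 else (nth (0, 0) r j).2)))
    0 (enum 'I_k).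

Definition bestM (S : seq (seq (bpoint d))) (w : seq R) :
    prog R (k.-tuple (bpoint d)) :=
  cols <-- foldM (fun cols (i : 'I_d) =>
             r <-- bit_countsM S w i ;;
             b <-- argminM (fM r) (enum (rels J i)) ;;
             Ret (rcons cols (odflt (nseq_tuple k false) b)))
           [::] (enum 'I_d) ;;
  steps (k * d)
    (Ret [tuple [tuple tnth (nth (nseq_tuple k false) cols i) j | i < d] | j < k]).

(* [None] is returned only if no candidate has been produced. *)
Definition GoodCenters (zero : bool) (tau eta zeta : nat) (B : {set bpoint d})
    (eps : R) : prog R (option (k.-tuple (bpoint d))) :=
  let X := enum (pts J) in
  D2 <-- D2weightsM (enum B) X ;;
  W <-- weightsM zero eps #|pts J| ;;
  ws <-- wordsM k W ;;
  CC <-- foldM (fun CC _ =>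
           M0 <-- sampleM X D2 (eta * k) ;;
           M <-- add_copiesM (tau * k) (enum B) M0 ;;
           Ss <-- disjointM tau k M ;;
           foldM (fun CC S =>
             foldM (fun CC w => D <-- bestM S w ;; Ret (rcons CC D)) CC ws)
             CC Ss)
         [::] (iota 0 zeta) ;;
  argminM (fun D : k.-tuple (bpoint d) => v <-- PhiM D X ;; Ret v%:R) CC.

End Algorithm.

(** * The parameters *)

(* Ceiling, truncated at 0 on negative numbers. *)
Definition natceil (R : realType) (x : R) : nat := `|(Num.ceil (Num.max x 0))%R|%N.

Definition tau_param (R : realType) (c : R) (k : nat) (eps : R) : nat :=
  natceil (c * (k%:R / eps ^+ 2 * ln (k%:R / eps))).

Definition eta_param (R : realType) (c : R) (tau : nat) (alpha : R) (k : nat)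
    (eps : R) : nat :=
  natceil (c * (tau%:R * alpha * k%:R / eps ^+ 2)).

Definition zeta_param (R : realType) (c : R) (eps : R) : nat :=
  natceil (c / eps).

(* GoodCenters(J, B, eps) for an alpha-approximate solution B, with hidden
   constants ctau, ceta, czeta. *)
Definition good_centers (R : realType) (ctau ceta czeta : R) (zero : bool)
    (alpha eps : R) d k (J : instance d k) (B : {set bpoint d}) :
    prog R (option (k.-tuple (bpoint d))) :=
  let tau := tau_param ctau k eps in
  GoodCenters J zero tau (eta_param ceta tau alpha k eps)
    (zeta_param czeta eps) B eps.

Definition log2 (R : realType) (x : R) : R := ln x / ln 2.

(* Main.v *)
(** The algorithm is analysed for one iteration; the later ones only add
  candidates.  Fix an optimal tuple and an optimal assignment, with clusters X_j.
  Call a point x of X_j near if Phi(B, X_j) is at most eps/(32 alpha k) Phi(B, X),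
  or if its distance to B is at most eps/128 times the mean distance in X_j; moving
  the near points to their nearest centers changes costs by at most eps/16 OPT in
  total, and these centers are available in tau k copies.  A far point is drawn
  with probability at least r/|X_j|, r = eps^2/(4096 alpha k), so by a coupling the
  sample dominates one where each X_j is hit with probability exactly r and
  uniformly; with high probability each cluster is hit tau times.  For a fixed
  coordinate, if p_j are the means of the bits of the moved clusters and p'_j those
  of the samples, termwise AM-GM shows that the chosen column has cost
    (1 - l) G(b) <= (1 + l) G(b0) + (1/l) \sum_j w_j (p'_j - p_j)^2
  for every admissible b0.  The variance of p'_j is at most 1/tau times the cost of
  b0 on cluster j, so Markov's inequality for the last sum, with l = eps/128,
  concludes. *)

Require Import Defs.
From HB Require Import structures.
From mathcomp Require Import all_boot all_order all_algebra.
From mathcomp Require Import all_classical all_reals all_analysis.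
From mathcomp Require Import ring lra zify.

Set Implicit Arguments.
Unset Strict Implicit.
Unset Printing Implicit Defensive.

Import Order.TTheory GRing.Theory Num.Theory.
Local Open Scope ring_scope.

(** * Programs: outcomes, running time, probability *)

(** The variance estimate needs unbiased samples of a cluster, but D^2-sampling only bounds the
    probability of a far point from below. Hence the coupling: what is analysed is an idealised
    sample with an extra outcome [None] that takes the remaining mass. As the algorithm enumerates
    all sub-multisets, it is enough that the actual sample contains the far points of the idealised
    one; near outcomes need no counterpart, their images being in B. The failure probability 1/4
    splits evenly between a cluster hit fewer than tau times and a deviation above eight times its
    mean. In the error budget, rounding cluster sizes up to weights costs a factor 1 + eps/2; the
    moved points and the sampling error fit into the other half of eps. When Phi(B,X) = 0, nothing
    bounds alpha from below and the hitting probability r is meaningless; but then no point is far,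
    and this case is settled without comparing the two samples. *)

Section Triples.
Variable R : realType.

(** Unlike [always], this also asks for draws with nonnegative weights of positive total, without
    which [prob] would not be a probability. *)
Fixpoint ok (A : Type) (P : A -> Prop) (c : prog R A) : Prop :=
  match c with
  | Ret a => P a
  | Step c' => ok P c'
  | Draw w g => [/\ forall v, v \in w -> 0 <= v, 0 < \sum_(v <- w) v
                  & forall i, (i < size w)%N -> ok P (g i)]
  end.

Definition triple (A : Type) (c : prog R A) (t : nat) (P : A -> Prop) : Prop :=
  ok P c /\ (time c <= t)%N.

Lemma ok_always A (P : A -> Prop) c : ok P c -> always P c.
Proof. by elim: c => //= w g IH [_ _ H] i /H /IH. Qed.

Lemma ok_bind A B (P : A -> Prop) (Q : B -> Prop) c (f : A -> prog R B) :
  ok P c -> (forall a, P a -> ok Q (f a)) -> ok Q (bind c f).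
Proof.
move=> + Hf; elim: c => [a /Hf|c IH|w g IH] //= [w0 w1 H].
by split=> // i iw; apply/IH/H.
Qed.

Lemma time_bind A B (P : A -> Prop) t c (f : A -> prog R B) :
  ok P c -> (forall a, P a -> (time (f a) <= t)%N) ->
  (time (bind c f) <= time c + t)%N.
Proof.
move=> + Hf; elim: c => [a /Hf|c IH /IH|w g IH [_ _ H]] //=.
rewrite -addnA leq_add2l; apply/bigmax_leqP => i _.
apply: leq_trans (IH _ (H _ (ltn_ord i))) _; rewrite leq_add2r.
by rewrite [leqRHS](bigD1 i) //= leq_maxl.
Qed.

Lemma triple_ret A (P : A -> Prop) (a : A) : P a -> triple (@Ret R A a) 0 P.
Proof. by []. Qed.

Lemma triple_step A (P : A -> Prop) c t :
  triple c t P -> triple (@Step R A c) t.+1 P.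
Proof. by []. Qed.

Lemma triple_steps A (P : A -> Prop) c t m :
  triple c t P -> triple (@steps R A m c) (m + t) P.
Proof. by move=> H; elim: m => //= m IH; apply: triple_step. Qed.

Lemma triple_bind A B (P : A -> Prop) (Q : B -> Prop) t1 t2 c
    (f : A -> prog R B) :
  triple c t1 P -> (forall a, P a -> triple (f a) t2 Q) ->
  triple (bind c f) (t1 + t2) Q.
Proof.
move=> [Hc tc] Hf; split; first by apply: ok_bind Hc _ => a /Hf [].
by apply: leq_trans (time_bind Hc (fun a Pa => (Hf a Pa).2)) _; rewrite leq_add2r.
Qed.

Lemma triple_bind_ret A B (P : A -> Prop) (Q : B -> Prop) t c
    (f : A -> prog R B) :
  triple c t P -> (forall a, P a -> triple (f a) 0 Q) -> triple (bind c f) t Q.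
Proof. by rewrite -[X in _ -> _ -> triple _ X _]addn0; apply: triple_bind. Qed.

Lemma ok_impl A (P Q : A -> Prop) (c : prog R A) :
  (forall a, P a -> Q a) -> ok P c -> ok Q c.
Proof.
move=> PQ; elim: c => [a /PQ|c IH|w g IH] //= [w0 w1 H].
by split=> // i iw; apply/IH/H.
Qed.

Lemma triple_weaken A (P Q : A -> Prop) t1 t2 (c : prog R A) :
  triple c t1 P -> (t1 <= t2)%N -> (forall a, P a -> Q a) -> triple c t2 Q.
Proof.
by move=> [Hc tc] t12 PQ; split; [exact: ok_impl PQ Hc|exact: leq_trans t12].
Qed.

Lemma triple_foldM A B (I : seq A -> B -> Prop) (f : B -> A -> prog R B) t b s :
  I [::] b ->
  (forall s' x b', I s' b' -> triple (f b' x) t (I (rcons s' x))) ->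
  triple (foldM f b s) (size s * t.+1) (I s).
Proof.
(* The consumed prefix is made explicit, as the induction must let it vary. *)
move=> I0 If; rewrite -[X in I X]/([::] ++ s).
elim: s [::] b I0 => [|x s IH] s0 b I0 /=; first by rewrite cats0.
rewrite mulSn addSn; apply: triple_step.
apply: triple_bind (If _ x _ I0) _ => b' /IH.
by rewrite cat_rcons.
Qed.

Lemma triple_foldM_in (A : eqType) B (I : seq A -> B -> Prop)
    (f : B -> A -> prog R B) t b s :
  I [::] b ->
  (forall s' x b', x \in s -> I s' b' -> triple (f b' x) t (I (rcons s' x))) ->
  triple (foldM f b s) (size s * t.+1) (I s).
Proof.
move=> I0 If; rewrite -[X in I X]/([::] ++ s).
elim: s [::] b I0 If => [|x s IH] s0 b I0 If /=; first by rewrite cats0.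
rewrite mulSn addSn; apply: triple_step.
apply: triple_bind (If _ x _ (mem_head _ _) I0) _ => b' /IH.
by rewrite cat_rcons; apply=> s' y b'' ys; apply: If; rewrite inE ys orbT.
Qed.

Lemma triple_argminM (A : eqType) (f : A -> prog R R) (g : A -> R) t s :
  (forall a, a \in s -> triple (f a) t (fun v => v = g a)) ->
  triple (argminM f s) (size s * t.+1)
    (fun o => if o is Some a then a \in s /\ forall a', a' \in s -> g a <= g a'
              else s = [::]).
Proof.
move=> Hf; rewrite /argminM.
pose I (s' : seq A) (m : option (A * R)) :=
  if m is Some (a, v) then [/\ a \in s', v = g a & forall a', a' \in s' -> g a <= g a']
  else s' = [::].
apply: (triple_bind_ret (P := I s)).
  apply: triple_foldM_in => // s' x m xs Im.
  apply: triple_bind_ret (Hf _ xs) _ => v ->; apply: triple_ret.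
  case: m Im => [[a v0] [as' -> amin]|->] /=.
    case: ltP => [lt|le]; split=> //; rewrite ?mem_rcons ?mem_head //.
    - move=> a'; rewrite mem_rcons inE => /orP[/eqP -> //|/amin].
      exact/le_trans/ltW.
    - by rewrite inE as' orbT.
    - by move=> a'; rewrite mem_rcons inE => /orP[/eqP -> //|/amin].
  split=> //; first by rewrite inE.
  by move=> a'; rewrite inE => /eqP ->.
by case=> [[a v] [as' _ amin]|->]; apply: triple_ret.
Qed.

Lemma bindA A B C (c : prog R A) (f : A -> prog R B) (g : B -> prog R C) :
  bind (bind c f) g = bind c (fun a => bind (f a) g).
Proof.
elim: c => //= [c ->//|w h IH]; congr Draw.
by apply/funext => i; apply: IH.
Qed.

Lemma prob_ge0 A (E : pred A) (P : A -> Prop) (c : prog R A) :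
  ok P c -> 0 <= prob E c.
Proof.
elim: c => [a _|c IH|w g IH] //=.
move=> [w0 w1 H]; apply: sumr_ge0 => i _; rewrite mulr_ge0 //.
  by rewrite divr_ge0 ?(ltW w1) // w0 // mem_nth.
by apply/IH/H.
Qed.

Lemma prob_bind_ge A B (E : pred B) (P : A -> Prop) (c : prog R A)
    (f : A -> prog R B) (r : R) :
  ok P c -> (forall a, P a -> r <= prob E (f a)) -> r <= prob E (bind c f).
Proof.
move=> + Hf; elim: c => [a /Hf|c IH|w g IH] //= [w0 w1 H].
(* The normalised weights sum to 1, so [r] is its own average over the draw. *)
have -> : r = \sum_(i < size w) (w`_i / \sum_(v <- w) v) * r.
  rewrite -mulr_suml -mulr_suml.
  rewrite -(big_mkord xpredT (nth 0 w)) -(big_nth 0 xpredT id).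
  by rewrite divff ?gt_eqF// mul1r.
apply: ler_sum => i _; rewrite ler_wpM2l //.
  by rewrite divr_ge0 ?(ltW w1) // w0 // mem_nth.
by apply/IH/H.
Qed.

Lemma prob_ok A (E : pred A) (P : A -> Prop) (c : prog R A) :
  ok P c -> (forall a, P a -> E a) -> 1 <= prob E c.
Proof.
(* Appending [Ret] makes the claim an instance of the bind rule. *)
move=> Hc PE; have: 1 <= prob E (bind c (@Ret R A)).
  by apply: prob_bind_ge Hc _ => a /PE /= ->.
suff -> : bind c (@Ret R A) = c by [].
by elim: c {Hc} => //= [c ->//|w g IH]; congr Draw; apply/funext.
Qed.

End Triples.

(** * Correctness and cost of the subroutines *)

(** The unit [e] takes part in the minimum, so it has to be compared with [m] as well. *)
Lemma leq_bigminP (I : finType) (P : pred I) (m e : nat) (F : I -> nat) :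
  reflect ((m <= e)%N /\ forall i, P i -> (m <= F i)%N)
          (m <= \big[minn/e]_(i | P i) F i)%N.
Proof.
apply: (iffP idP) => [|[me mF]]; last first.
  by elim/big_rec: _ => // i x Pi mx; rewrite leq_min mF.
suff H s : (m <= \big[minn/e]_(i <- s | P i) F i)%N ->
    (m <= e)%N /\ forall i, i \in s -> P i -> (m <= F i)%N.
  by move=> /H[me mF]; split=> // i; apply: mF; rewrite mem_index_enum.
elim: s => [|c s IH]; first by rewrite big_nil.
rewrite big_cons; case: ifP => Pc; rewrite ?leq_min.
  by move=> /andP[mc /IH[me mF]]; split=> // i; rewrite inE => /orP[/eqP ->|/mF].
move=> /IH[me mF]; split=> // i; rewrite inE => /orP[/eqP ->|/mF //].
by rewrite Pc.
Qed.

Section Specs.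
Variable R : realType.

Lemma triple_foldM_sum (A : Type) (f : A -> nat) (g : A -> prog R nat) t s :
  (forall a, triple (g a) t (fun h => h = f a)) ->
  triple (foldM (fun s y => m <-- g y ;; Ret (s + m)%N) 0%N s)
         (size s * t.+1) (fun h => h = (\sum_(y <- s) f y)%N).
Proof.
move=> Hg; apply: (triple_foldM (I := fun s' h => h = (\sum_(y <- s') f y)%N)).
  by rewrite big_nil.
move=> s' x b ->; apply: triple_bind_ret (Hg x) _ => _ ->.
by apply: triple_ret; rewrite -cats1 big_cat big_seq1.
Qed.

Lemma triple_hammingM d (x y : bpoint d) :
  triple (hammingM R x y) d (fun h => h = hamming x y).
Proof.
have := @triple_foldM_sum _ (fun i : 'I_d => tnth x i != tnth y i : nat)
  (fun i => Ret (tnth x i != tnth y i : nat)) 0 (enum 'I_d) (fun a => triple_ret R (erefl _)).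
by rewrite size_enum_ord muln1 big_enum.
Qed.

Lemma triple_dist_toM d (C : seq (bpoint d)) x :
  triple (dist_toM R C x) (size C * d.+1) (fun m => m = dist_to [set c in C] x).
Proof.
(* The running minimum is described by its lower bounds. This ignores the order and the repetitions
   of the list, and so compares directly with a minimum over a set. *)
pose I (s : seq (bpoint d)) m :=
  forall p, (p <= m)%N = (p <= d)%N && all (fun c => p <= hamming x c)%N s.
apply: (triple_weaken (P := I C) _ (leqnn _)).
  apply: triple_foldM => [p|s' c m Im]; first by rewrite andbT.
  apply: triple_bind_ret (triple_hammingM x c) _ => _ ->.
  by apply: triple_ret => p; rewrite leq_min Im all_rcons andbCA andbC andbA.
move=> m Im; apply/eqP; rewrite eqn_leq.
have := Im m; rewrite leqnn => /esym/andP[md /allP mC].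
have /leq_bigminP[m'd m'C] := leqnn (dist_to [set c in C] x).
apply/andP; split.
  by apply/leq_bigminP; split=> // c; rewrite inE; apply: mC.
by rewrite Im m'd; apply/allP => c cC; apply: m'C; rewrite inE.
Qed.

Lemma triple_PhiM d (C Y : seq (bpoint d)) :
  triple (PhiM R C Y) (size Y * (size C * d.+1).+1)
    (fun s => s = (\sum_(y <- Y) dist_to [set c in C] y)%N).
Proof. exact/triple_foldM_sum/triple_dist_toM. Qed.

Definition D2weights d (B : {set bpoint d}) (X : seq (bpoint d)) : seq R :=
  [seq if (\sum_(y <- X) dist_to B y == 0)%N then 1 else (dist_to B x)%:R
  | x <- X].

Lemma triple_D2weightsM d (B : {set bpoint d}) (X : seq (bpoint d)) :
  triple (D2weightsM R (enum B) X) (size X * (#|B| * d.+1 + 3))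
    (fun w => w = D2weights B X).
Proof.
rewrite (_ : _ * _ = size X * (#|B| * d.+1).+1 + (size X * 1 + size X * 1))%N; last by lia.
apply: (triple_bind (P := fun w => w = [seq (dist_to B x)%:R | x <- X])).
  apply: (triple_foldM (I := fun s w => w = [seq (dist_to B x)%:R | x <- s])) => //.
  move=> s x w ->.
  have := triple_dist_toM (enum B) x; rewrite -cardE set_enum => H.
  by apply: triple_bind_ret H _ => m ->; apply: triple_ret; rewrite map_rcons.
move=> _ ->.
apply: (triple_bind (P := fun t => t = (\sum_(y <- X) dist_to B y)%:R)).
  rewrite -(size_map (fun x => (dist_to B x)%:R : R) X).
  apply: (triple_weaken (P := fun t => t = \sum_(v <- [seq (dist_to B x)%:R | x <- X]) v) _ (leqnn _)).
    apply: (triple_foldM (I := fun s t => t = \sum_(v <- s) v)); first by rewrite big_nil.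
    by move=> s v t ->; apply: triple_ret; rewrite -cats1 big_cat big_seq1.
  by move=> t ->; rewrite big_map natr_sum.
move=> _ ->; rewrite -{1}(size_map (fun x => (dist_to B x)%:R : R) X).
apply: (triple_weaken (P := fun w =>
  w = [seq if (\sum_(y <- X) dist_to B y)%:R == 0 :> R then 1 else v
      | v <- [seq (dist_to B x)%:R | x <- X]]) _ (leqnn _)).
  apply: (triple_foldM (I := fun s w =>
    w = [seq if (\sum_(y <- X) dist_to B y)%:R == 0 :> R then 1 else v | v <- s])) => //.
  by move=> s v w ->; apply: triple_ret; rewrite map_rcons.
by move=> w ->; rewrite -map_comp pnatr_eq0.
Qed.

Lemma triple_weightsM (zero : bool) (eps : R) n :
  triple (weightsM zero eps n) (logceil (1 + eps / 2) n).+1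
    (fun W => [/\ size W = (zero + (logceil (1 + eps / 2) n).+1)%N,
       forall t, (t <= logceil (1 + eps / 2) n)%N -> (1 + eps / 2) ^+ t \in W
       & zero -> 0 \in W]).
Proof.
set L := logceil _ _; rewrite -{1}(size_iota 0 L.+1) -[X in triple _ X _]muln1.
pose I (s : seq nat) (r : seq R * R) :=
  r.1 = (if zero then [:: 0] else [::]) ++ [seq (1 + eps / 2) ^+ t | t <- iota 0 (size s)]
  /\ r.2 = (1 + eps / 2) ^+ size s.
apply: (triple_bind_ret (P := I (iota 0 L.+1))).
  apply: triple_foldM; first by rewrite /I cats0.
  move=> s x [r1 r2] [/= -> ->]; apply: triple_ret.
  rewrite /I size_rcons -[(size s).+1]addn1 iotaD map_cat exprD.
  by split=> //=; rewrite rcons_cat cats1.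
move=> r [-> _]; apply: triple_ret; rewrite size_iota {I}; split.
- by rewrite size_cat size_map size_iota; case: zero.
- move=> t tL; rewrite mem_cat; apply/orP; right.
  by apply/mapP; exists t => //; rewrite mem_iota.
- by move=> ->; rewrite mem_head.
Qed.

Lemma triple_foldM_catrev (A B : Type) (g : A -> B) (r : seq B) (s : seq A) :
  triple (foldM (fun r x => @Ret R _ (g x :: r)) r s) (size s)
    (fun r' => r' = catrev (map g s) r).
Proof.
rewrite -[size s]muln1.
apply: (triple_foldM (I := fun s r' => r' = catrev (map g s) r)) => // s' x b ->.
by apply: triple_ret; rewrite map_rcons -cats1 catrev_catl.
Qed.

Lemma triple_wordsM l (W : seq R) : (0 < size W)%N ->
  triple (wordsM l W) (2 * l * size W ^ l)
    (fun ws => size ws = (size W ^ l)%N /\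
       forall u, size u = l -> {subset u <= W} -> u \in ws).
Proof.
move=> W0; elim: l => [|l IH] /=.
  by apply: triple_ret; split=> // -[].
(* The bound is split into the cost of the recursive call and a remainder that pays for the two
   nested loops. *)
rewrite (_ : (2 * l.+1 * _ =
  2 * l * size W ^ l + (2 * l * (size W ^ l) * (size W).-1 + 2 * size W ^ l.+1)))%N; last first.
  case: (size W) W0 => // m _; rewrite expnS /=.
  by move: (m.+1 ^ l)%N => p; nia.
apply: triple_bind IH _ => us [sus Hus].
apply: (triple_weaken (t1 := (size W * (size us).+1)%N) (P := fun r =>
  size r = (size W * size us)%N /\ forall w u, w \in W -> u \in us -> w :: u \in r)).
- pose I (s : seq R) (r : seq (seq R)) := size r = (size s * size us)%N /\
    forall w u, w \in s -> u \in us -> w :: u \in r.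
  apply: (triple_foldM (I := I)) => // s x r [sr Hr].
  apply: triple_weaken (triple_foldM_catrev _ _ _) (leqnn _) _ => _ ->.
  rewrite /I catrevE size_cat size_rev size_map size_rcons sr mulSn; split=> // w u.
  rewrite mem_rcons inE mem_cat mem_rev => /orP[/eqP -> uus|ws uus].
    by rewrite map_f.
  by rewrite Hr ?orbT.
- rewrite sus expnS; apply: leq_trans (leq_addl _ _).
  by rewrite mulnS mul2n -addnn leq_add2r leq_pmulr // expn_gt0 W0.
- move=> ws [sws Hws]; split; first by rewrite sws sus expnS.
  case=> // w u [su] sub; apply: Hws; first by apply: sub; rewrite mem_head.
  by apply: Hus => // v vu; apply: sub; rewrite inE vu orbT.
Qed.

Lemma triple_add_copiesM d t (B M : seq (bpoint d)) :
  triple (add_copiesM R t B M) (size B * t.+1)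
    (fun M' => size M' = (size M + size B * t)%N /\
       forall z, count_mem z M' = (count_mem z M + t * count_mem z B)%N).
Proof.
pose I (s M' : seq (bpoint d)) := size M' = (size M + size s * t)%N /\
  forall z, count_mem z M' = (count_mem z M + t * count_mem z s)%N.
apply: (triple_foldM (I := I)).
  by split=> *; rewrite ?mul0n ?muln0 addn0.
move=> s b M' [sM' cM'].
pose I' (i : seq nat) (M'' : seq (bpoint d)) := M'' = M' ++ nseq (size i) b.
apply: (triple_weaken (t1 := (size (iota 0 t) * 1)%N) (P := I' (iota 0 t))).
  apply: triple_foldM; first by rewrite /I' cats0.
  move=> i x _ ->; apply: triple_ret.
  by rewrite /I' size_rcons rcons_cat -cats1 -(nseqD _ 1) addn1.
  by rewrite size_iota muln1.
move=> _ ->; rewrite size_iota; split.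
  by rewrite size_cat sM' size_nseq size_rcons mulSn [(t + _)%N]addnC addnA.
move=> z; rewrite count_cat cM' count_nseq -cats1 count_cat /=; lia.
Qed.

End Specs.

Lemma leq_expn2r e m n : (m <= n)%N -> (m ^ e <= n ^ e)%N.
Proof. by case: e => [//|e] mn; rewrite leq_exp2r. Qed.

(** * Enumeration of disjoint sub-multisets *)

Section Enumeration.
Variables (R : realType) (d : nat).
Implicit Types M S : seq (bpoint d).

Lemma triple_foldM_rev (A B : Type) (g : A -> B) (r : seq B) (s : seq A) :
  triple (foldM (fun r x => @Ret R _ (g x :: r)) r s) (size s)
    (fun r' => r' = rev (map g s) ++ r).
Proof. by rewrite -catrevE; apply: triple_foldM_catrev. Qed.

(** The two recursive calls follow Pascal's recurrence, which (size M + 1)^t dominates, so the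
    enumeration is polynomial in the size of [M] for fixed [t]. Completeness is up to permutation,
    since picks keep the order of [M]. *)
Lemma triple_picksM M t :
  triple (picksM R M t) (3 * (size M).+1 ^ t.+1)
    (fun ps => [/\ (size ps <= (size M).+1 ^ t)%N,
      forall p, p \in ps -> size p.1 = t /\ (size p.2 <= size M)%N
    & forall S, size S = t ->
        (forall z, count_mem z S <= count_mem z M)%N ->
        exists2 p, p \in ps & perm_eq S p.1 /\ perm_eq (p.1 ++ p.2) M]).
Proof.
elim: M t => [|x M IH] [|t] /=.
- apply: triple_step; apply: triple_ret; split=> // [p|S /size0nil -> _].
    by rewrite inE => /eqP ->.
  by exists ([::], [::]); rewrite ?mem_head.
- apply: (triple_weaken (t1 := 1%N) (P := fun ps => ps = [::])) => //; last first.
    move=> _ ->; split=> // S tS /(_ (head (nseq_tuple d false) S)).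
    by case: S tS => [//|a S _] /=; rewrite eqxx.
  by rewrite muln_gt0 expn_gt0.
- apply: (triple_weaken (t1 := 1%N) (P := fun ps => ps = [:: ([::], x :: M)])) => //; last first.
    move=> _ ->; split=> // [p|S /size0nil -> _].
      by rewrite inE => /eqP ->.
    by exists ([::], x :: M); rewrite ?mem_head.
set m := (size M).+1.
apply: (triple_weaken (t1 := (3 * m ^ t.+1 + (3 * m ^ t.+2 + (m ^ t + m ^ t.+1))).+1%N)
  (P := fun ps => exists a b, ps = rev (map (fun p => (p.1, x :: p.2)) b) ++
     (rev (map (fun p => (x :: p.1, p.2)) a) ++ [::]) /\
  ([/\ (size a <= m ^ t)%N,
      forall p, p \in a -> size p.1 = t /\ (size p.2 <= size M)%N
    & forall S, size S = t ->
        (forall z, count_mem z S <= count_mem z M)%N ->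
        exists2 p, p \in a & perm_eq S p.1 /\ perm_eq (p.1 ++ p.2) M] /\
  [/\ (size b <= m ^ t.+1)%N,
      forall p, p \in b -> size p.1 = t.+1 /\ (size p.2 <= size M)%N
    & forall S, size S = t.+1 ->
        (forall z, count_mem z S <= count_mem z M)%N ->
        exists2 p, p \in b & perm_eq S p.1 /\ perm_eq (p.1 ++ p.2) M]))).
- apply: triple_step; apply: triple_bind (IH t) _ => a Ha.
  apply: triple_bind (IH t.+1) _ => b Hb.
  apply: triple_bind (triple_weaken (triple_foldM_rev _ _ _) _ (fun r h => h)) _.
    by case: Ha.
  move=> _ ->; apply: triple_weaken (triple_foldM_rev _ _ _) _ _.
    by case: Hb.
  by move=> _ ->; exists a, b.
- have : (m ^ t <= m.+1 ^ t)%N by rewrite leq_expn2r.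
  rewrite !expnS; have : (0 < m ^ t)%N by rewrite expn_gt0.
  by move: (m ^ t)%N (m.+1 ^ t)%N => p p'; nia.
- move=> _ [a [b [-> [[sa Ha Ca] [sb Hb Cb]]]]]; split.
  + rewrite !size_cat !size_rev !size_map addn0.
    have : (m ^ t <= m.+1 ^ t)%N by rewrite leq_expn2r.
    move: sa sb; rewrite !expnS.
    by move: (m ^ t)%N (m.+1 ^ t)%N => p p'; nia.
  + move=> p; rewrite cats0 mem_cat !mem_rev => /orP[] /mapP[p' /= p'in ->] /=.
      by have [-> ?] := Hb _ p'in.
    by have [-> ?] := Ha _ p'in; split=> //; apply: leqW.
  (* If [x] occurs in [S], the head copy goes to [S] and cancels from both multiplicities; otherwise
     it is left over. *)
  + move=> S tS cS; case: (boolP (x \in S)) => xS.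
      have pS := perm_to_rem xS.
      have [| |p pa [Sp pM]] := Ca (rem x S); first by rewrite size_rem // tS.
        by move=> z; have := cS z; rewrite (permP pS (pred1 z)) /= leq_add2l.
      exists (x :: p.1, p.2).
        by rewrite cats0 mem_cat !mem_rev; apply/orP; right; apply/mapP; exists p.
      by rewrite /= perm_cons pM (perm_trans pS) ?perm_cons.
    have [|p pb [Sp pM]] := Cb S tS.
      move=> z; have := cS z; rewrite /=; case: eqVneq => // <- _.
      by rewrite (count_memPn xS).
    exists (p.1, x :: p.2).
      by rewrite cats0 mem_cat !mem_rev; apply/orP; left; apply/mapP; exists p.
    split=> //=; rewrite -cat1s perm_catCA /=.
    by rewrite perm_cons.
Qed.

(** Disjointness of the groups of [F] inside [M] is expressed by the multiplicities of their
    concatenation. *)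
Definition pick_family t l M (qs : seq (seq (seq (bpoint d)))) : Prop :=
  [/\ (size qs <= (size M).+1 ^ (t * l))%N,
      forall q, q \in qs -> size q = l /\ forall S, S \in q -> size S = t
    & forall F, size F = l -> (forall S, S \in F -> size S = t) ->
        (forall z, count_mem z (flatten F) <= count_mem z M)%N ->
        exists2 q, q \in qs & forall j, perm_eq (nth [::] F j) (nth [::] q j)].

Lemma triple_disjointM t l M :
  triple (disjointM R t l M) (5 * l * (size M).+1 ^ (t * l).+1)
    (pick_family t l M).
Proof.
elim: l M => [|l IH] M /=.
  apply: triple_ret; split=> //.
  - by rewrite muln0.
  - by move=> q; rewrite inE => /eqP ->.
  - by move=> F /size0nil -> _ _; exists [::]; rewrite ?mem_head.
set m := (size M).+1.
pose T := (5 * l * m ^ (t * l).+1)%N.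
apply: (triple_weaken (t1 := (3 * m ^ t.+1 + m ^ t * (T + m ^ (t * l)).+1)%N)
  (P := pick_family t l.+1 M)) => //.
- apply: triple_bind (triple_picksM M t) _ => ps [sps Hps Cps].
  pose I (s : seq (seq (bpoint d) * seq (bpoint d))) (r : seq (seq (seq (bpoint d)))) :=
    [/\ (size r <= size s * m ^ (t * l))%N,
      forall q, q \in r -> size q = l.+1 /\ forall S, S \in q -> size S = t
    & forall p, p \in s -> forall F, size F = l ->
        (forall S, S \in F -> size S = t) ->
        (forall z, count_mem z (flatten F) <= count_mem z p.2)%N ->
        exists2 q, p.1 :: q \in r & forall j, perm_eq (nth [::] F j) (nth [::] q j)].
  apply: (triple_weaken (t1 := (size ps * (T + m ^ (t * l)).+1)%N) (P := I ps)).
  + apply: triple_foldM_in => // s p r pps [sr Hr Cr].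
    have [sp1 sp2] := Hps _ pps.
    have le_m u : ((size p.2).+1 ^ u <= m ^ u)%N by rewrite leq_expn2r.
    apply: (triple_bind (P := pick_family t l p.2)).
      apply: triple_weaken (IH p.2) _ (fun _ h => h).
      by rewrite leq_mul2l le_m orbT.
    move=> qs [sqs Hqs Cqs].
    apply: triple_weaken (triple_foldM_rev _ _ _) (leq_trans sqs (le_m _)) _.
    move=> _ ->; split.
    * rewrite size_cat size_rev size_map size_rcons mulSn leq_add //.
      exact: leq_trans sqs (le_m _).
    * move=> q; rewrite mem_cat mem_rev => /orP[/mapP[q' q'qs ->] /=|/Hr //].
      have [-> Hq'] := Hqs _ q'qs; split=> // S.
      by rewrite inE => /orP[/eqP ->|/Hq'].
    * move=> p'; rewrite mem_rcons inE => /orP[/eqP ->|p's] F sF HF cF.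
        have [q qqs Fq] := Cqs F sF HF cF.
        by exists q => //; rewrite mem_cat mem_rev map_f.
      have [q qr Fq] := Cr _ p's F sF HF cF.
      by exists q => //; rewrite mem_cat qr orbT.
  + by rewrite leq_mul2r sps orbT.
  + move=> r [sr Hr Cr]; split=> //.
      by apply: leq_trans sr _; rewrite mulnS expnD leq_mul2r sps orbT.
    case=> // S F [sF] HF cF.
    have [| |p pps [Sp1 pM]] := Cps S; first by rewrite HF ?mem_head.
      by move=> z; apply: leq_trans (cF z); rewrite /= count_cat leq_addr.
    have [||q qr Fq] := Cr _ pps F sF; first by move=> S' S'F; rewrite HF // inE S'F orbT.
      move=> z; have := cF z; rewrite /= count_cat -(permP pM) count_cat.
      by rewrite (permP Sp1) leq_add2l.
    by exists (p.1 :: q) => // -[|j] //=.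
- have -> : (t * l.+1).+1 = (t + (t * l).+1)%N by rewrite mulnS addnS.
  rewrite /T {T} expnD !expnS.
  have : (0 < m ^ t)%N by rewrite expn_gt0.
  have : (0 < m ^ (t * l))%N by rewrite expn_gt0.
  have : (0 < m)%N by [].
  move: m (m ^ t)%N (m ^ (t * l))%N => b p p' b0 p'0 p0.
  (* Every term is compared with the product of [p], [b] and [p'], after which the claim is
     linear. *)
  have h1 : (p * 1 <= p * (b * p'))%N by rewrite leq_mul2l muln_gt0 b0 p'0 orbT.
  have h2 : (p * p' <= p * (b * p'))%N by rewrite leq_mul2l leq_pmull ?orbT.
  have h3 : (p * b <= p * (b * p'))%N by rewrite leq_mul2l leq_pmulr ?orbT.
  have -> : (p * (5 * l * (b * p') + p').+1 =
             5 * l * (p * (b * p')) + p * p' + p * 1)%N by ring.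
  have -> : (5 * l.+1 * (p * (b * p')) = 5 * l * (p * (b * p')) + 5 * (p * (b * p')))%N by ring.
  by move: h1 h2 h3; rewrite [(b * p)%N]mulnC; lia.
Qed.

End Enumeration.

(** * The choice of columns and one iteration of the algorithm *)

Section Best.
Variables (R : realType) (d k : nat) (J : instance d k).

(** The function f_i of the subroutine: an element counts when its bit differs from the one chosen
    for its group. *)
Definition flip_cost (S : seq (seq (bpoint d))) (w : seq R) (i : 'I_d)
    (b : k.-tuple bool) : R :=
  \sum_(j < k) w`_j * (count (fun x => tnth x i != tnth b j) (nth [::] S j))%:R.

Definition bit_counts (S : seq (seq (bpoint d))) (w : seq R) (i : 'I_d) (j : 'I_k) :=
  (w`_j * (count (fun x => ~~ tnth x i) (nth [::] S j))%:R,
   w`_j * (count (fun x => tnth x i) (nth [::] S j))%:R).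

Lemma triple_bit_countsM S w i t :
  (forall j, size (nth [::] S j) <= t)%N ->
  triple (bit_countsM k S w i) (k * t.+1)
    (fun r => r = map (bit_counts S w i) (enum 'I_k)).
Proof.
move=> St; have -> : (k * t.+1 = size (enum 'I_k) * t.+1)%N by rewrite size_enum_ord.
apply: (triple_foldM (I := fun s r => r = map (bit_counts S w i) s)) => // s j _ ->.
pose I (s : seq (bpoint d)) n :=
  n = (count (fun x => ~~ tnth x i) s, count (fun x => tnth x i) s).
apply: (triple_bind_ret (P := I (nth [::] S j))).
  apply: (triple_weaken (t1 := (size (nth [::] S j) * 1)%N)); last first.
  - by move=> n; apply.
  - by rewrite muln1.
  apply: triple_foldM => // s' x _ ->; apply: triple_ret.
  by rewrite /I -cats1 !count_cat /=; case: (tnth x i); rewrite ?addn0 ?addn1.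
by move=> _ ->; apply: triple_ret; rewrite map_rcons.
Qed.

Lemma triple_fM S w i b :
  triple (fM (map (bit_counts S w i) (enum 'I_k)) b) k
    (fun v => v = flip_cost S w i b).
Proof.
pose F (j : 'I_k) := w`_j * (count (fun x => tnth x i != tnth b j) (nth [::] S j))%:R.
apply: (triple_weaken (P := fun v => v = \sum_(j <- enum 'I_k) F j)
  (t1 := (size (enum 'I_k) * 1)%N)); last 2 first.
  by rewrite muln1 size_enum_ord.
  by move=> v ->; rewrite big_enum.
apply: (triple_foldM (I := fun s v => v = \sum_(j <- s) F j)); first by rewrite big_nil.
move=> s j _ ->; apply: triple_ret; rewrite -cats1 big_cat big_seq1; congr (_ + _).
rewrite (nth_map j) ?size_enum_ord// nth_ord_enum /bit_counts /F.
case: (tnth b j) => /=; congr (_ * _%:R); apply: eq_count => x.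
  by rewrite eqb_id.
by case: (tnth x i).
Qed.

(** The guard lets this hold of the default column as well; feasibility discharges it later. *)
Definition best_for S w (D : k.-tuple (bpoint d)) : Prop :=
  forall i, (exists b, b \in rels J i) ->
    column D i \in rels J i /\
    forall b, b \in rels J i -> flip_cost S w i (column D i) <= flip_cost S w i b.

Definition best_time t := (d * (k * t.+1 + 2 ^ k * k.+1 + 1) + k * d)%N.

Lemma triple_bestM S w t : (forall j, size (nth [::] S j) <= t)%N ->
  triple (bestM J S w) (best_time t) (best_for S w).
Proof.
move=> St; pose dflt := nseq_tuple k false.
pose good (i : 'I_d) (c : k.-tuple bool) := (exists b, b \in rels J i) ->
  c \in rels J i /\ forall b, b \in rels J i -> flip_cost S w i c <= flip_cost S w i b.
pose I (s : seq 'I_d) (cols : seq (k.-tuple bool)) :=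
  size cols = size s /\ forall p, p \in zip s cols -> good p.1 p.2.
apply: (triple_bind (P := I (enum 'I_d))).
  have -> : (d * (k * t.+1 + 2 ^ k * k.+1 + 1) =
             size (enum 'I_d) * (k * t.+1 + 2 ^ k * k.+1).+1)%N.
    by rewrite size_enum_ord addn1.
  apply: triple_foldM => // s i cols [sc Hc].
  apply: triple_bind (triple_bit_countsM w i St) _ => _ ->.
  apply: triple_bind_ret.
    apply: triple_weaken (triple_argminM _) _ (fun o h => h).
      by move=> b _; apply: triple_fM.
    rewrite leq_mul2r /= -cardE; apply: leq_trans (max_card _) _.
    by rewrite card_tuple card_bool.
  move=> o Ho; apply: triple_ret; split; first by rewrite !size_rcons sc.
  move=> p; rewrite zip_rcons// mem_rcons inE => /orP[/eqP -> /=|/Hc //].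
  case: o Ho => [b [bi bmin]|/= e] [b' b'i].
    rewrite mem_enum in bi; split=> // b'' b''i; apply: bmin.
    by rewrite mem_enum.
  by move: b'i; rewrite -mem_enum e.
move=> cols [sc Hc]; rewrite -[X in triple _ X _]addn0; apply: triple_steps.
apply: triple_ret => i.
set D := [tuple _ | j < k].
have -> : column D i = nth dflt cols i.
  by apply: eq_from_tnth => j; rewrite !tnth_mktuple.
apply: (Hc (i, nth dflt cols i)).
have -> : (i, nth dflt cols i) = nth (i, dflt) (zip (enum 'I_d) cols) i.
  by rewrite nth_zip// nth_ord_enum.
by rewrite mem_nth// size_zip sc minnn size_enum_ord.
Qed.

Lemma best_for_satisfies S w D : feasible J -> best_for S w D -> satisfies J D.
Proof.
move=> [D0 /forallP HD0] HD; apply/forallP => i.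
by have [] := HD i (ex_intro (fun b => b \in rels J i) _ (HD0 i)).
Qed.

Lemma triple_sampleM (X : seq (bpoint d)) (w : seq R) N :
  size w = size X -> (forall v, v \in w -> 0 <= v) -> 0 < \sum_(v <- w) v ->
  triple (sampleM X w N) (N * (size X).+1) (fun M => size M = N).
Proof.
move=> sw w0 w1.
apply: (triple_weaken (t1 := (size (iota 0 N) * (size X).+1)%N)
  (P := fun M => size M = size (iota 0 N))); last 2 first.
- by rewrite size_iota.
- by move=> M; rewrite size_iota.
apply: (triple_foldM (I := fun s M => size M = size s)) => // s x M sM.
split=> /=; last first.
  rewrite sw -[leqRHS]addn0 leq_add2l.
  by apply/bigmax_leqP.
by split=> // i _; rewrite !size_rcons sM.
Qed.

(* [S] can be enumerated once the sample is [M0]: the pool then consists of [M0]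
   and of [t * k] copies of every element of [B]. *)
Definition available t (B : {set bpoint d}) (M0 : seq (bpoint d)) S :=
  [/\ size S = k, forall j : 'I_k, size (nth [::] S j) = t
  & forall z, (count_mem z (flatten S) <= count_mem z M0 + t * k * (z \in B))%N].

Lemma flip_cost_perm S S' w i b :
  (forall j, perm_eq (nth [::] S j) (nth [::] S' j)) ->
  flip_cost S w i b = flip_cost S' w i b.
Proof. by move=> SS'; apply: eq_bigr => j _; rewrite (permP (SS' j)). Qed.

Lemma best_for_perm S S' w D :
  (forall j, perm_eq (nth [::] S j) (nth [::] S' j)) ->
  best_for S' w D -> best_for S w D.
Proof.
move=> SS' HD i /HD[cD Dmin]; split=> // b /Dmin.
by rewrite !(flip_cost_perm _ _ _ SS').
Qed.

(* The body of the loop of [GoodCenters], without the sampling. *)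
Definition scanM (tau : nat) (B : {set bpoint d}) (ws : seq (seq R))
    (CC : seq (k.-tuple (bpoint d))) (M0 : seq (bpoint d)) :=
  M <-- add_copiesM R (tau * k) (enum B) M0 ;;
  Ss <-- disjointM R tau k M ;;
  foldM (fun CC S =>
    foldM (fun CC w => D <-- bestM J S w ;; Ret (rcons CC D)) CC ws) CC Ss.

Definition pool_size tau N b := (N + b * (tau * k))%N.

Definition scan_time tau N b W : nat :=
  let m := pool_size tau N b in
  (b * (tau * k).+1 + (5 * k * m.+1 ^ (tau * k).+1 +
   m.+1 ^ (tau * k) * (W * (best_time tau).+1).+1))%N.

(** The interface to the probabilistic part: candidates are never lost, so later iterations cannot
    hurt, and an available family with listed weights always contributes an optimal choice of
    columns. *)
Lemma triple_scanM tau B ws CC M0 :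
  triple (scanM tau B ws CC M0) (scan_time tau (size M0) #|B| (size ws))
    (fun CC' => [/\ (size CC' <= size CC +
          (pool_size tau (size M0) #|B|).+1 ^ (tau * k) * size ws)%N,
      {subset CC <= CC'},
      feasible J -> all (satisfies J) CC -> all (satisfies J) CC'
    & forall S w, available tau B M0 S -> w \in ws ->
        exists2 D, D \in CC' & best_for S w D]).
Proof.
set m := pool_size _ _ _.
have := triple_add_copiesM R (tau * k) (enum B) M0; rewrite -cardE => HM.
apply: triple_bind HM _ => M [sM cM].
have := triple_disjointM R tau k M; rewrite sM -/(pool_size _ _ _) -/m => HS.
apply: triple_bind HS _ => Ss; rewrite /pick_family sM -/(pool_size _ _ _) -/m.
move=> [sSs Hsz Cs].
pose I s C := [/\ size C = (size CC + size s * size ws)%N,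
  {subset CC <= C}, feasible J -> all (satisfies J) CC -> all (satisfies J) C
  & forall S w, S \in s -> w \in ws -> exists2 D, D \in C & best_for S w D].
apply: (triple_weaken (t1 := (size Ss * (size ws * (best_time tau).+1).+1)%N)
  (P := I Ss)).
- apply: triple_foldM_in; first by split; rewrite ?addn0.
  move=> s S C SSs [sC CCC aC HC].
  pose I' v C' := [/\ size C' = (size C + size v)%N,
    {subset C <= C'}, feasible J -> all (satisfies J) C -> all (satisfies J) C'
    & forall w, w \in v -> exists2 D, D \in C' & best_for S w D].
  apply: (triple_weaken (P := I' ws) _ (leqnn _)).
    apply: triple_foldM; first by split; rewrite ?addn0.
    move=> v w C' [sC' CC' aC' HC'].
    have St j : (size (nth [::] S j) <= tau)%N.
      case: (ltnP j (size S)) => jS; last by rewrite nth_default.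
      by have [_ ->] := Hsz _ SSs; rewrite ?mem_nth.
    apply: triple_bind_ret (triple_bestM w St) _ => D HD; apply: triple_ret; split.
    + by rewrite !size_rcons sC' addnS.
    + by move=> D' /CC'; rewrite mem_rcons inE orbC => ->.
    + move=> fJ aJ; rewrite all_rcons (best_for_satisfies fJ HD) /=.
      exact: aC'.
    + move=> w'; rewrite mem_rcons inE => /orP[/eqP ->|/HC'[D' D'C HD']].
        by exists D; rewrite ?mem_rcons ?mem_head.
      by exists D' => //; rewrite mem_rcons inE D'C orbT.
  move=> C' [sC' CC' aC' HC']; split.
  + by rewrite sC' sC size_rcons mulSnr addnA.
  + by move=> D /CCC /CC'.
  + by move=> fJ aJ; apply: aC' => //; apply: aC.
  + move=> S' w; rewrite mem_rcons inE => /orP[/eqP ->|S's] wws; first exact: HC'.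
    by have [D /CC'] := HC _ _ S's wws; exists D.
- by rewrite leq_mul2r sSs orbT.
- move=> C [sC CCC aC HC]; split=> //.
    by rewrite sC leq_add2l leq_mul2r sSs orbT.
  move=> S w [sS HS cS] wws.
  have [||q qSs Sq] := Cs S sS.
  + move=> S0 /(nthP [::])[j]; rewrite sS => jk <-.
    by rewrite -(HS (Ordinal jk)).
  + move=> z; apply: leq_trans (cS z) _; rewrite cM.
    by rewrite (count_uniq_mem _ (enum_uniq _)) mem_enum.
  have [D DC HD] := HC _ _ qSs wws; exists D => //.
  exact: best_for_perm HD.
Qed.

End Best.

(** * Independent draws *)

Section IteratedExpectation.
Variable R : realType.

(** Expectation of [F] over [n] independent draws from [p], unfolded one draw at a time in step with
    the sampling loop. *)
Fixpoint Ex (T : finType) (p : T -> R) n (F : seq T -> R) : R :=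
  if n is n'.+1 then \sum_x p x * Ex p n' (fun s => F (x :: s)) else F [::].

Section Theory.
Variables (T : finType) (p : T -> R).

Lemma eq_Ex n F G : F =1 G -> Ex p n F = Ex p n G.
Proof.
elim: n F G => [|n IH] F G FG /=; first by apply: FG.
by apply: eq_bigr => x _; congr (_ * _); apply: IH => s; apply: FG.
Qed.

Lemma ExD n F G : Ex p n (fun s => F s + G s) = Ex p n F + Ex p n G.
Proof.
elim: n F G => [|n IH] F G //=; rewrite -big_split /=.
by apply: eq_bigr => x _; rewrite IH mulrDr.
Qed.

Lemma ExZ n c F : Ex p n (fun s => c * F s) = c * Ex p n F.
Proof.
elim: n F => [|n IH] F //=; rewrite mulr_sumr.
by apply: eq_bigr => x _; rewrite IH mulrCA.
Qed.

Lemma Ex0 n : Ex p n (fun=> 0) = 0.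
Proof. by have := ExZ n 0 (fun=> 0); rewrite !mul0r. Qed.

Lemma Ex_sum (I : Type) (r : seq I) (P : pred I) n (F : I -> seq T -> R) :
  Ex p n (fun s => \sum_(i <- r | P i) F i s) = \sum_(i <- r | P i) Ex p n (F i).
Proof.
elim: r => [|i r IH].
  by rewrite big_nil (eq_Ex _ (G := fun=> 0)) ?Ex0 // => s; rewrite big_nil.
rewrite big_cons -IH; case: ifP => Pi.
  by rewrite -ExD; apply: eq_Ex => s; rewrite big_cons Pi.
by apply: eq_Ex => s; rewrite big_cons Pi.
Qed.

Hypothesis p_ge0 : forall x, 0 <= p x.

Lemma Ex_le n F G : (forall s, size s = n -> F s <= G s) -> Ex p n F <= Ex p n G.
Proof.
elim: n F G => [|n IH] F G FG /=; first by apply: FG.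
apply: ler_sum => x _; rewrite ler_wpM2l //; apply: IH => s sn.
by apply: FG; rewrite /= sn.
Qed.

Lemma Ex_ge0 n F : (forall s, 0 <= F s) -> 0 <= Ex p n F.
Proof. by move=> F0; rewrite -(Ex0 n); apply: Ex_le. Qed.

Hypothesis p_sum1 : \sum_x p x = 1.

Lemma Ex_cst n c : Ex p n (fun=> c) = c.
Proof. by elim: n => //= n IH; rewrite IH -mulr_suml p_sum1 mul1r. Qed.

Lemma Ex_eq0 n Z : (forall s, 0 <= Z s) -> Ex p n Z = 0 ->
  Ex p n (fun s => (0 < Z s)%R%:R) = 0.
Proof.
elim: n Z => [|n IH] Z Z0 /=; first by move=> ->; rewrite ltxx.
move/eqP; rewrite psumr_eq0 => [/allP H|x _]; last by rewrite mulr_ge0 // Ex_ge0.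
apply: big1 => x _; have := H x (mem_index_enum _).
rewrite mulf_eq0 => /orP[/eqP ->|/eqP /IH ->]; rewrite ?mul0r ?mulr0 //.
Qed.

(** The event is strict so that the bound persists for [mu = 0], where dividing by [mu] is
    impossible. This occurs when the optimal cost vanishes. *)
Lemma Ex_markov n Z (mu c : R) : 0 < c -> (forall s, 0 <= Z s) -> Ex p n Z <= mu ->
  Ex p n (fun s => (c * mu < Z s)%R%:R) <= c^-1.
Proof.
move=> c0 Z0 Zmu; have := le_trans (Ex_ge0 n Z0) Zmu.
rewrite le_eqVlt => /orP[/eqP mu0|mu0].
  rewrite -mu0 mulr0 Ex_eq0 // ?invr_ge0 ?(ltW c0) //.
  by apply/eqP; rewrite eq_le Ex_ge0 // mu0 Zmu.
apply: (@le_trans _ _ (Ex p n (fun s => (c * mu)^-1 * Z s))).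
  apply: Ex_le => s _; case: ltP => [lt|_].
    by rewrite mulrC ler_pdivlMr ?mulr_gt0 // mul1r ltW.
  by rewrite mulr_ge0 // invr_ge0 mulr_ge0 ?ltW.
rewrite ExZ invfM -mulrA ler_piMr ?invr_ge0 ?(ltW c0) //.
by rewrite mulrC ler_pdivrMr // mul1r.
Qed.

(** Variance of a sum of independent centered variables; the offset [c] absorbs the first draw in
    the induction. *)
Lemma Ex_sqr_sum n (h : T -> R) v (c : R) :
  \sum_x p x * h x = 0 -> \sum_x p x * h x ^+ 2 = v ->
  Ex p n (fun s => (c + \sum_(x <- s) h x) ^+ 2) = c ^+ 2 + n%:R * v.
Proof.
move=> h1 h2; elim: n c => [|n IH] c /=; first by rewrite big_nil mul0r !addr0.
rewrite (eq_bigr (fun x => p x * (c ^+ 2 + n%:R * v) + 2 * c * (p x * h x)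
                         + p x * h x ^+ 2)); last first.
  move=> x _; rewrite (eq_Ex _ (G := fun s => (c + h x + \sum_(y <- s) h y) ^+ 2)).
    by rewrite IH; ring.
  by move=> s; rewrite big_cons addrA.
rewrite !big_split /= -mulr_suml -mulr_sumr p_sum1 h1 h2 -natr1; ring.
Qed.

End Theory.

Lemma big_option (T : finType) (F : option T -> R) :
  \sum_x F x = F None + \sum_x F (Some x).
Proof.
rewrite (bigD1 None) //=; congr (_ + _).
rewrite (reindex_omap Some id) => [|[x|]] //=.
by apply: eq_bigl => x; rewrite eqxx.
Qed.

(** * Coupling of the actual sample with an idealised one *)

Section Coupling.
Variables (T : finType) (p : T -> R) (q : option T -> R) (far : pred T).
Hypothesis p_ge0 : forall x, 0 <= p x.
Hypothesis q_ge0 : forall y, 0 <= q y.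
Hypothesis p_sum1 : \sum_x p x = 1.
Hypothesis q_sum1 : \sum_y q y = 1.
Hypothesis q_le_p : forall x, far x -> q (Some x) <= p x.
Hypothesis q_None : 0 < q None.

(** Only far outcomes are tied to the actual draw: near ones will be replaced by centers, which are
    in the pool anyway. *)
Definition compat (x : T) (y : option T) : bool :=
  if y is Some x' then far x' ==> (x' == x) else true.

Definition near (y : option T) : bool := if y is Some x then ~~ far x else true.

Lemma big_near (F : option T -> R) :
  \sum_(y | near y) F y = F None + \sum_(x | ~~ far x) F (Some x).
Proof. by rewrite big_mkcond big_option /= -big_mkcond. Qed.

(** The mass that [q] gives to a far point is coupled to the same point, which [p] can afford. The
    rest of [p] is paired with the near outcomes as a product, all such pairs being compatible. *)
Lemma coupling1 (F : T -> R) (G : option T -> R) :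
  (forall x y, compat x y -> G y <= F x) ->
  \sum_y q y * G y <= \sum_x p x * F x.
Proof.
move=> GF; pose r := \sum_(y | near y) q y; pose a := \sum_(y | near y) q y * G y.
have r0 : 0 < r.
  by rewrite /r (bigD1 None) //= ltr_wpDr // sumr_ge0.
have qr : \sum_(x | far x) q (Some x) = 1 - r.
  by rewrite -q_sum1 big_option /r big_near [X in _ = _ + X - _](bigID far) /=; ring.
have aF x : a <= r * F x.
  rewrite /a /r mulr_suml; apply: ler_sum => y ny; rewrite ler_wpM2l // GF //.
  by case: y ny => //= x' /negPf ->.
have -> : \sum_y q y * G y = \sum_(x | far x) q (Some x) * G (Some x) + a.
  by rewrite /a big_option big_near [X in _ + X = _](bigID far) /=; ring.
(* What is left of [p] after the diagonal part; its total is the near mass [r] of [q]. *)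
pose p' x := if far x then p x - q (Some x) else p x.
have p'0 x : 0 <= p' x by rewrite /p'; case: ifP => // /q_le_p; rewrite subr_ge0.
have p'r : \sum_x p' x = r.
  have -> : r = 1 - \sum_(x | far x) q (Some x) by rewrite qr; ring.
  rewrite -p_sum1 (big_mkcond far) -sumrB /=; apply: eq_bigr => x _; rewrite /p'.
  by case: ifP; rewrite ?subr0.
have -> : \sum_x p x * F x = \sum_(x | far x) q (Some x) * F x + \sum_x p' x * F x.
  rewrite (big_mkcond far) -big_split /=; apply: eq_bigr => x _; rewrite /p'.
  by case: ifP => _; ring.
apply: lerD.
  apply: ler_sum => x fx; rewrite ler_wpM2l // GF //=.
  by rewrite eqxx implybT.
(* Multiplying by [r], positive thanks to [None], turns the normalised product coupling into a
   double sum. *)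
rewrite -(ler_pM2l r0) [leRHS]mulr_sumr -{1}p'r mulr_suml.
by apply: ler_sum => x _; rewrite [leRHS]mulrCA ler_wpM2l.
Qed.

Lemma coupling n (F : seq T -> R) (G : seq (option T) -> R) :
  (forall xs ys, size xs = n -> all2 compat xs ys -> G ys <= F xs) ->
  Ex q n G <= Ex p n F.
Proof.
elim: n F G => [|n IH] F G GF /=; first exact: GF.
apply: coupling1 => x y xy; apply: IH => xs ys sxs c.
by apply: GF; rewrite /= ?sxs ?xy.
Qed.

End Coupling.

(* Rejection sampling: [class] is hit with probability [r], and a hit follows the
   law [u]; the first [t] hits are then independent with law [u]. *)
Section Hits.
Variables (T : finType) (q : option T -> R) (class : pred T) (r : R) (u : T -> R).
Hypothesis q_ge0 : forall y, 0 <= q y.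
Hypothesis q_sum1 : \sum_y q y = 1.
Hypothesis r_ge0 : 0 <= r.
Hypothesis u_ge0 : forall x, 0 <= u x.
Hypothesis u_sum1 : \sum_x u x = 1.
Hypothesis u_class : forall x, ~~ class x -> u x = 0.
Hypothesis q_class : forall x, class x -> q (Some x) = r * u x.

Definition hits (ys : seq (option T)) : seq T := [seq x <- pmap id ys | class x].

Definition is_hit (y : option T) : bool := if y is Some x then class x else false.

Lemma hits_cons y ys :
  hits (y :: ys) = if y is Some x then if class x then x :: hits ys else hits ys
                   else hits ys.
Proof. by rewrite /hits; case: y. Qed.

Lemma sum_hit (G : option T -> R) :
  \sum_y q y * G y = r * (\sum_x u x * G (Some x)) + \sum_(y | ~~ is_hit y) q y * G y.
Proof.
rewrite (bigID is_hit) /=; congr (_ + _).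
rewrite big_mkcond big_option /= add0r mulr_sumr; apply: eq_bigr => x _.
by case: ifP => [/q_class ->|/negbT/u_class ->]; rewrite ?mul0r ?mulr0 ?mulrA.
Qed.

Lemma sum_miss : \sum_(y | ~~ is_hit y) q y = 1 - r.
Proof.
have := sum_hit (fun=> 1); rewrite -!mulr_suml !mulr1 u_sum1 q_sum1 mulr1.
by move=> ->; ring.
Qed.

(** By conditioning on the first draw: with probability [r] it is a hit and supplies the first draw
    from [u], otherwise the bound for the remaining draws applies. It is an inequality because runs
    with fewer than [t] hits count as 0. *)
Lemma Ex_first_hits n t (phi : seq T -> R) : (forall s, 0 <= phi s) ->
  Ex q n (fun ys => (t <= size (hits ys))%N%:R * phi (take t (hits ys)))
  <= Ex u t phi.
Proof.
elim: n t phi => [|n IH] t phi phi0 /=.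
  case: t => [|t]; first by rewrite mul1r.
  by rewrite mul0r Ex_ge0.
case: t => [|t].
  rewrite (eq_bigr (fun y => q y * phi [::])); last first.
    move=> y _; rewrite (eq_Ex _ _ (G := fun=> phi [::])) ?Ex_cst // => s.
    by rewrite take0 mul1r.
  by rewrite -mulr_suml q_sum1 mul1r.
rewrite sum_hit.
have H x : u x * Ex q n (fun s => (t.+1 <= size (hits (Some x :: s)))%N%:R *
      phi (take t.+1 (hits (Some x :: s)))) <=
    u x * Ex u t (fun s => phi (x :: s)).
  case: (boolP (class x)) => [cx|/u_class ->]; last by rewrite !mul0r.
  rewrite ler_wpM2l //; apply: le_trans (IH t (fun s => phi (x :: s)) _) => //.
  by rewrite (eq_Ex _ _ (G := fun ys => (t <= size (hits ys))%N%:R * phi (x :: take t (hits ys)))) => // s; rewrite hits_cons cx.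
have H' y : ~~ is_hit y -> q y * Ex q n (fun s => (t.+1 <= size (hits (y :: s)))%N%:R *
      phi (take t.+1 (hits (y :: s)))) <= q y * Ex u t.+1 phi.
  move=> ny; rewrite ler_wpM2l //; apply: le_trans (IH t.+1 phi phi0).
  rewrite (eq_Ex _ _ (G := fun ys => (t.+1 <= size (hits ys))%N%:R * phi (take t.+1 (hits ys)))) => // s.
  by rewrite hits_cons; case: y ny => //= x /negPf ->.
apply: le_trans (lerD (ler_wpM2l r_ge0 (ler_sum _ (fun x _ => H x))) (ler_sum _ H')) _.
by rewrite -mulr_suml sum_miss /=; lra.
Qed.

(** Generating function of the number of hits, which is binomial with parameters [n] and [r]. *)
Lemma Ex_expn_hits n (a : R) :
  Ex q n (fun ys => a ^+ size (hits ys)) = (1 - r * (1 - a)) ^+ n.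
Proof.
elim: n => //= n IH; rewrite sum_hit.
rewrite (eq_bigr (fun x => u x * (a * (1 - r * (1 - a)) ^+ n))); last first.
  move=> x _; case: (boolP (class x)) => [cx|/u_class ->]; last by rewrite !mul0r.
  rewrite -IH -(ExZ q n a); congr (_ * _); apply: eq_Ex => s.
  by rewrite hits_cons cx /= exprS.
rewrite [X in _ + X](eq_bigr (fun y => q y * (1 - r * (1 - a)) ^+ n)); last first.
  move=> y ny; rewrite -IH; congr (_ * _); apply: eq_Ex => s.
  by rewrite hits_cons; case: y ny => //= x /negPf ->.
by rewrite -!mulr_suml u_sum1 sum_miss exprS; ring.
Qed.

(** Chernoff bound: the indicator is at most 2^(t - hits), whose mean is given by the generating
    function at 1/2; then 2 <= e and 1 - r/2 <= exp(-r/2). *)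
Lemma Ex_few_hits n t : r <= 1 ->
  Ex q n (fun ys => (size (hits ys) < t)%N%:R) <= expR (t%:R - r * n%:R / 2).
Proof.
move=> r1.
apply: (@le_trans _ _ (Ex q n (fun ys => 2 ^+ t * 2^-1 ^+ size (hits ys)))).
  apply: Ex_le => // s _; rewrite exprVn; case: ltnP => [lt|_].
    by rewrite ler_pdivlMr ?exprn_gt0 // mul1r ler_eXn2l ?ltr1n // ltnW.
  by rewrite divr_ge0 ?exprn_ge0.
rewrite ExZ Ex_expn_hits (_ : 1 - _ = 1 - r / 2); last by lra.
have -> : t%:R - r * n%:R / 2 = t%:R * 1 + n%:R * - (r / 2) :> R by ring.
rewrite expRD !expRM_natl ler_pM ?exprn_ge0 ?lerXn2r ?nnegrE ?expR_ge0 //; try lra.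
- by have := expR_ge1Dx (1 : R); lra.
- by have := expR_ge1Dx (- (r / 2)); lra.
Qed.

End Hits.

End IteratedExpectation.

(** * Correctness and cost of the algorithm *)

Section GoodCentersSpec.
Variables (R : realType) (d k : nat) (J : instance d k) (B : {set bpoint d}).
Variables (zero : bool) (tau eta zeta : nat) (eps : R).

Local Notation n := #|pts J|.
Local Notation L := (logceil (1 + eps / 2) n).
Local Notation W := (zero + L.+1)%N.
Local Notation m := (pool_size k tau (eta * k) #|B|).
Local Notation CCsize := (m.+1 ^ (tau * k) * W ^ k)%N.

Definition total_time : nat :=
  (n * (#|B| * d.+1 + 3) + (L.+1 + (2 * k * W ^ k +
   (zeta * (eta * k * n.+1 + scan_time d k tau (eta * k) #|B| (W ^ k)).+1 +
    (zeta * CCsize) * (n * (k * d.+1).+1).+1))))%N.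

Hypotheses (k_gt0 : (0 < k)%N) (n_gt0 : (0 < n)%N) (cardB : #|B| = k).

Lemma D2weights_ge0 v : v \in D2weights R B (enum (pts J)) -> 0 <= v.
Proof. by case/mapP => x _ ->; case: ifP => _. Qed.

Lemma D2weights_sum_gt0 : 0 < \sum_(v <- D2weights R B (enum (pts J))) v.
Proof.
rewrite big_map; case: eqP => [_|/eqP ne0].
  by rewrite (eq_bigr (fun=> 1%:R)) // -natr_sum ltr0n sum1_size -cardE.
by rewrite -natr_sum ltr0n lt0n.
Qed.

(** Whatever the sample, [k] groups of copies of a single center can be chosen; hence the candidate
    list is nonempty and the result is never [None]. *)
Lemma available_copies M0 b : b \in B ->
  available k tau B M0 (nseq k (nseq tau b)).
Proof.
move=> bB; split=> [|j|z]; first by rewrite size_nseq.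
  by rewrite nth_nseq ltn_ord size_nseq.
apply: leq_trans (leq_addl _ _).
have -> : flatten (nseq k (nseq tau b)) = nseq (tau * k) b.
  by elim: k => [|l IH]; rewrite ?muln0 //= IH mulnS nseqD.
rewrite count_nseq /= mulnC leq_mul2l; case: (b =P z) => [<-|_]; last by rewrite orbT.
by rewrite bB orbT.
Qed.

Lemma iteration_triple ws CC :
  triple (M0 <-- sampleM (enum (pts J)) (D2weights R B (enum (pts J))) (eta * k) ;;
          scanM J tau B ws CC M0)
    (eta * k * n.+1 + scan_time d k tau (eta * k) #|B| (size ws))
    (fun CC' => [/\ (size CC' <= size CC + m.+1 ^ (tau * k) * size ws)%N,
      {subset CC <= CC'}, feasible J -> all (satisfies J) CC -> all (satisfies J) CC'
    & (0 < size ws)%N -> CC' != [::]]).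
Proof.
rewrite [in X in triple _ X _]cardE.
apply: (triple_bind (P := fun M => size M = (eta * k)%N)).
  by apply: triple_sampleM D2weights_sum_gt0; rewrite ?size_map //; apply: D2weights_ge0.
move=> M0 sM0; have := triple_scanM J tau B ws CC M0; rewrite sM0 => H.
apply: triple_weaken H (leqnn _) _ => CC' [sCC' CCC' aCC' HCC']; split=> // ws0.
have /card_gt0P[b bB] : (0 < #|B|)%N by rewrite cardB.
have [D DCC _] := HCC' _ _ (available_copies M0 bB) (mem_nth [::] ws0).
by apply/eqP => e; rewrite e in DCC.
Qed.

Lemma loop_triple ws CC (s : seq nat) :
  triple (foldM (fun CC _ =>
      M0 <-- sampleM (enum (pts J)) (D2weights R B (enum (pts J))) (eta * k) ;;
      scanM J tau B ws CC M0) CC s)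
    (size s * (eta * k * n.+1 + scan_time d k tau (eta * k) #|B| (size ws)).+1)
    (fun CC' => [/\ (size CC' <= size CC + size s * (m.+1 ^ (tau * k) * size ws))%N,
      {subset CC <= CC'}, feasible J -> all (satisfies J) CC -> all (satisfies J) CC'
    & (0 < size ws)%N -> (0 < size s)%N -> CC' != [::]]).
Proof.
pose I (s : seq nat) CC' := [/\ (size CC' <= size CC + size s * (m.+1 ^ (tau * k) * size ws))%N,
      {subset CC <= CC'}, feasible J -> all (satisfies J) CC -> all (satisfies J) CC'
    & (0 < size ws)%N -> (0 < size s)%N -> CC' != [::]].
apply: (triple_foldM (I := I)); first by split; rewrite ?addn0.
move=> s' x C [sC CCC aC HC].
apply: triple_weaken (iteration_triple ws C) (leqnn _) _.
move=> C' [sC' CC' aC' HC']; split.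
- apply: leq_trans sC' _; rewrite size_rcons mulSnr addnA leq_add2r.
  exact: sC.
- by move=> D /CCC /CC'.
- by move=> fJ aJ; apply: aC' => //; apply: aC.
- by move=> ws0 _; apply: HC'.
Qed.

Definition cost (D : k.-tuple (bpoint d)) : nat := Phi (centers D) (pts J).

Lemma final_triple CC :
  triple (argminM (fun D : k.-tuple (bpoint d) =>
            v <-- PhiM R D (enum (pts J)) ;; Ret v%:R) CC)
    (size CC * (n * (k * d.+1).+1).+1)
    (fun o => if o is Some D then D \in CC /\ forall D', D' \in CC ->
       (cost D <= cost D')%N else CC = [::]).
Proof.
apply: (triple_weaken (t1 := (size CC * (n * (k * d.+1).+1).+1)%N) (P := fun o =>
   if o is Some D then D \in CC /\ forall D', D' \in CC ->
       (cost D)%:R <= (cost D')%:R :> R else CC = [::])) => //.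
  apply: triple_argminM => D _.
  have := triple_PhiM R D (enum (pts J)); rewrite -cardE size_tuple => H.
  apply: triple_bind_ret H _ => _ ->; apply: triple_ret.
  by rewrite big_enum.
by case=> [D [DCC Dmin]|//]; split=> // D' /Dmin; rewrite ler_nat.
Qed.

Lemma triple_GoodCenters : (0 < zeta)%N ->
  triple (GoodCenters J zero tau eta zeta B eps) total_time
    (fun o => exists2 D, o = Some D & feasible J -> satisfies J D).
Proof.
move=> zeta0; rewrite /GoodCenters /total_time.
have HD := triple_D2weightsM R B (enum (pts J)); rewrite -cardE in HD.
apply: triple_bind HD _ => _ ->.
apply: triple_bind (triple_weightsM zero eps n) _ => Ws [sW HW HW0].
have W0 : (0 < size Ws)%N by rewrite sW addnS.
have := triple_wordsM k W0; rewrite sW => Hws.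
apply: triple_bind Hws _ => ws [sws Hws].
have ws0 : (0 < W ^ k)%N by rewrite -sW expn_gt0 W0.
have := loop_triple ws [::] (iota 0 zeta); rewrite size_iota sws => Hloop.
apply: triple_bind Hloop _ => CC [sCC _ aCC CC0].
apply: triple_weaken (final_triple CC) _ _.
  by rewrite leq_mul2r sCC orbT.
case=> [D [DCC _]|e]; last by have := CC0 ws0 zeta0; rewrite e.
by exists D => // fJ; have /allP := aCC fJ isT; apply.
Qed.

(** The law of one drawn point, extended by 0 to the whole cube, the finite type over which [Ex]
    sums. *)
Definition D2prob (x : bpoint d) : R :=
  if x \in pts J then
    (if Phi B (pts J) == 0%N then 1 else (dist_to B x)%:R) /
    \sum_(v <- D2weights R B (enum (pts J))) v
  else 0.

Lemma D2prob_ge0 x : 0 <= D2prob x.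
Proof.
rewrite /D2prob; case: ifP => // _; apply: divr_ge0; first by case: ifP.
exact/ltW/D2weights_sum_gt0.
Qed.

Lemma D2weightsE : D2weights R B (enum (pts J)) =
  [seq if Phi B (pts J) == 0%N then 1 else (dist_to B x)%:R | x <- enum (pts J)].
Proof. by apply: eq_map => x; rewrite big_enum. Qed.

Lemma sum_D2prob (G : bpoint d -> R) :
  let w := D2weights R B (enum (pts J)) in
  \sum_(i < size w) (w`_i / \sum_(v <- w) v) *
     G (nth (nseq_tuple d false) (enum (pts J)) i) = \sum_x D2prob x * G x.
Proof.
move=> w; have sw : size w = size (enum (pts J)) by rewrite size_map.
transitivity (\sum_(x <- enum (pts J)) D2prob x * G x); last first.
  rewrite big_enum /= big_mkcond; apply: eq_bigr => x _.
  by rewrite /D2prob; case: (x \in pts J); rewrite ?mul0r.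
rewrite (big_nth (nseq_tuple d false)) big_mkord sw; apply: eq_bigr => i _.
congr (_ * _); rewrite /D2prob -mem_enum mem_nth // -/w.
by rewrite {1}/w D2weightsE (nth_map (nseq_tuple d false)).
Qed.

Lemma D2prob_sum1 : \sum_x D2prob x = 1.
Proof.
transitivity (\sum_x D2prob x * 1); first by apply: eq_bigr => x _; rewrite mulr1.
rewrite -(sum_D2prob (fun=> 1)); set w := D2weights _ _ _.
rewrite -mulr_suml -mulr_suml mulr1 -(big_mkord xpredT (nth 0 w)).
by rewrite -(big_nth 0 xpredT id) divff ?gt_eqF ?D2weights_sum_gt0.
Qed.

Lemma prob_sampleM A (E : pred A) N (f : seq (bpoint d) -> prog R A) :
  prob E (bind (sampleM (enum (pts J)) (D2weights R B (enum (pts J))) N) f) =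
  Ex D2prob N (fun M => prob E (f M)).
Proof.
rewrite /sampleM -[RHS](eq_Ex D2prob N (F := fun M => prob E (f ([::] ++ M)))) //.
elim: N 0%N [::] => [|N IH] a M0 /=; first by rewrite cats0.
rewrite -sum_D2prob; apply: eq_bigr => i _; congr (_ * _).
by rewrite IH; apply: eq_Ex => s; rewrite cat_rcons.
Qed.

(* A good sample of the first iteration suffices: later iterations only add
   candidates. *)
Lemma prob_GoodCenters (E : pred nat) : (0 < zeta)%N ->
  (forall u v, (u <= v)%N -> E v -> E u) ->
  Ex D2prob (eta * k) (fun M0 => (`[< exists S w,
     [/\ available k tau B M0 S, size w = k,
         forall j : 'I_k, w`_j = 0 /\ zero \/
           exists2 t, (t <= L)%N & w`_j = (1 + eps / 2) ^+ t
       & forall D, best_for J S w D -> E (cost D)] >])%:R)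
  <= prob (fun o => if o is Some D then E (cost D) else false)
       (GoodCenters J zero tau eta zeta B eps).
Proof.
case: zeta => // z _ mono; rewrite /GoodCenters.
have [HD _] := triple_D2weightsM R B (enum (pts J)).
apply: prob_bind_ge HD _ => _ ->.
have [Hw _] := triple_weightsM zero eps n.
apply: prob_bind_ge Hw _ => Ws [sW HW HW0].
have W0 : (0 < size Ws)%N by rewrite sW addnS.
have [Hws _] := triple_wordsM k W0.
apply: prob_bind_ge Hws _ => ws [sws Hws].
(* The first iteration is unrolled and its sampling brought to the front. *)
rewrite /= bindA bindA prob_sampleM.
apply: Ex_le => [x|M0 sM0]; first exact: D2prob_ge0.
have [Hscan _] := triple_scanM J tau B ws [::] M0.
have rest_ok C : ok (fun _ => True)
    (bind (foldM (fun CC _ =>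
      M0 <-- sampleM (enum (pts J)) (D2weights R B (enum (pts J))) (eta * k) ;;
      scanM J tau B ws CC M0) C (iota 1 z))
    (argminM (fun D : k.-tuple (bpoint d) =>
            v <-- PhiM R D (enum (pts J)) ;; Ret v%:R))).
  apply: ok_bind (loop_triple ws C (iota 1 z)).1 _ => CC _.
  exact: ok_impl (final_triple CC).1.
case: asboolP => [[S [w [Sav sw Hwj HE]]]|_]; last first.
  by apply: prob_ge0; apply: ok_bind Hscan _ => C _; apply: rest_ok.
apply: prob_bind_ge Hscan _ => C [_ _ _ HC].
have wws : w \in ws.
  apply: Hws => // v /(nthP 0)[j]; rewrite sw => jk <-.
  have [[-> /HW0 //]|[t tL ->]] := Hwj (Ordinal jk).
  exact: HW.
have [D DC /HE ED] := HC _ _ Sav wws.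
apply: prob_bind_ge (loop_triple ws C (iota 1 z)).1 _ => CC [_ sub _ _].
apply: prob_ok (final_triple CC).1 _ => -[D' [_ D'min]|e]; last first.
  by have := sub _ DC; rewrite e.
by apply: mono ED; apply/D'min/sub.
Qed.

End GoodCentersSpec.

(** * Sampling from the clusters *)

Section BitCost.
Variable R : realType.

(* Fraction of disagreement with [b] of a population of bits of mean [p]. *)
Definition bitcost (p : R) (b : bool) : R := if b then 1 - p else p.

Lemma bitcost_ge0 p b : 0 <= p <= 1 -> 0 <= bitcost p b.
Proof. by rewrite /bitcost; case: b; lra. Qed.

Lemma sum_bitcost (T : Type) (s : seq T) (P : pred T) (f : T -> bool) (m : R) b :
  \sum_(x <- s | P x) 1 = m -> m != 0 ->
  \sum_(x <- s | P x) (f x != b)%:R =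
  m * bitcost ((\sum_(x <- s | P x) (f x)%:R) / m) b.
Proof.
move=> sm m0; have mK : m * ((\sum_(x <- s | P x) (f x)%:R) / m) = \sum_(x <- s | P x) (f x)%:R.
  by rewrite mulrC divfK.
rewrite /bitcost; case: b; last by rewrite mK; apply: eq_bigr => x _; case: (f x).
rewrite mulrBr mK mulr1 -{1}sm -sumrB; apply: eq_bigr => x _.
by case: (f x); rewrite ?subrr ?subr0.
Qed.

(* AM-GM; if [b != b0], the two costs add up to 1. *)
Lemma bitcost_deviation (l p ph : R) b b0 : 0 < l -> 0 <= p <= 1 ->
  (bitcost p b - bitcost p b0) - (bitcost ph b - bitcost ph b0)
  <= l * (bitcost p b + bitcost p b0) + (ph - p) ^+ 2 / l.
Proof.
move=> l0 p01.
have sq x : 2 * x <= l + x ^+ 2 / l.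
  rewrite -subr_ge0 (_ : _ - _ = (l - x) ^+ 2 / l); last by field; rewrite gt_eqF.
  by rewrite divr_ge0 ?sqr_ge0 // ltW.
have sq0 : 0 <= (ph - p) ^+ 2 / l by rewrite divr_ge0 ?sqr_ge0 // ltW.
have := sq (ph - p); have := sq (p - ph); rewrite -[(p - ph) ^+ 2]sqrrN opprB.
by rewrite /bitcost; case: b; case: b0 => h1 h2; nra.
Qed.

End BitCost.

(** The error budget: sampling costs a factor (1 + 3e/128)/(1 - e/128) <= 1 + e/16, the weights cost
    1 + e/2, and moving the points enters twice, as 1 + e/16 for the optimum and as an additive e/16
    for the chosen tuple. *)
Lemma cost_arith (R : realType) (e c mv m0 m G0 G V O : R) :
  0 < e -> e <= 1 / 2 -> c <= mv + m -> m0 <= mv + O -> mv <= e / 16 * O ->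
  m <= G -> G0 <= (1 + e / 2) * m0 -> V <= e / 64 * G0 ->
  (1 - e / 128) * G <= (1 + e / 128) * G0 + V -> 0 <= G0 -> 0 <= O ->
  c <= (1 + e) * O.
Proof.
move=> e0 e1 hc hm0 hmv hm hG0 hV hG G0_ge0 O0.
have GG0 : G <= (1 + e / 16) * G0.
  have l0 : 0 < 1 - e / 128 by lra.
  rewrite -(ler_pM2l l0); apply: le_trans hG _.
  apply: (@le_trans _ _ ((1 + 3 * e / 128) * G0)); first by lra.
  by rewrite mulrA ler_wpM2r //; nra.
have m0O : m0 <= (1 + e / 16) * O by lra.
have G0O : G0 <= (1 + e / 2) * ((1 + e / 16) * O).
  by apply: le_trans hG0 _; rewrite ler_wpM2l //; lra.
have GO : G <= (1 + e / 16) * ((1 + e / 2) * ((1 + e / 16) * O)).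
  by apply: le_trans GG0 _; rewrite ler_wpM2l //; lra.
have H : e / 16 + (1 + e / 16) * ((1 + e / 2) * (1 + e / 16)) <= 1 + e by nra.
by have := ler_wpM2r O0 H; lra.
Qed.

Section Hamming.
Variable d : nat.
Implicit Types x y z : bpoint d.

Lemma hammingC x y : hamming x y = hamming y x.
Proof. by apply: eq_bigr => i _; rewrite eq_sym. Qed.

Lemma hamming_triangle x y z : (hamming x z <= hamming x y + hamming y z)%N.
Proof.
rewrite -big_split; apply: leq_sum => i _ /=.
by case: (tnth x i) (tnth y i) (tnth z i) => -[] [].
Qed.

Lemma hamming_refl x : hamming x x = 0%N.
Proof. by apply: big1 => i _; rewrite eqxx. Qed.

Lemma hamming_le x y : (hamming x y <= d)%N.
Proof.
rewrite -[X in (_ <= X)%N](card_ord d) -sum1_card; apply: leq_sum => i _.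
by case: (_ != _).
Qed.

Lemma dist_to_le (C : {set bpoint d}) c x : c \in C -> (dist_to C x <= hamming x c)%N.
Proof.
move=> cC; have /leq_bigminP[_ H] := leqnn (dist_to C x).
exact: H.
Qed.

End Hamming.

(** * Cost of the tuple chosen from a good sample *)

Section Clustering.
Variables (R : realType) (d k : nat) (J : instance d k) (B : {set bpoint d}).
Variables (D0 : k.-tuple (bpoint d)) (s : bpoint d -> 'I_k).
(* [pr x] is [x] if [x] is far from [B], and a nearest center otherwise. *)
Variables (pr : bpoint d -> bpoint d) (far : pred (bpoint d)).
Variables (w : 'I_k -> R) (eps : R) (tau : nat) (b0 : bpoint d).

Definition cluster_of (j : 'I_k) := [set x in pts J | s x == j].

Definition mean (i : 'I_d) (j : 'I_k) : R :=
  (\sum_(x in cluster_of j) (tnth (pr x) i)%:R) / #|cluster_of j|%:R.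

Definition sample_mean (i : 'I_d) (T : seq (bpoint d)) : R :=
  (\sum_(x <- T) (tnth (pr x) i)%:R) / tau%:R.

(** The cost G, with [w j] in place of the size of the j-th moved cluster. Points keep the
    assignment [s], which cannot undercut the nearest one. *)
Definition weighted_cost (D : k.-tuple (bpoint d)) : R :=
  \sum_i \sum_j w j * bitcost (mean i j) (tnth (column D i) j).

Definition cluster_deviation (j : 'I_k) (T : seq (bpoint d)) : R :=
  w j * \sum_i (sample_mean i T - mean i j) ^+ 2.

(** The algorithm wants [tau] elements in every group; an empty cluster gets copies of a center,
    harmless because its weight is 0. *)
Definition sample_family (T : 'I_k -> seq (bpoint d)) : seq (seq (bpoint d)) :=
  [seq if (0 < #|cluster_of j|)%N then map pr (T j) else nseq tau b0 | j <- enum 'I_k].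

Definition weight_seq : seq R := [seq w j | j <- enum 'I_k].

Definition moved_cost (D : k.-tuple (bpoint d)) : nat :=
  (\sum_(x in pts J) hamming (pr x) (tnth D (s x)))%N.

Hypothesis eps_bounds : 0 < eps <= 1 / 2.
Hypothesis tau_big : 256 * 256 / eps ^+ 2 <= tau%:R.
Hypothesis w_empty : forall j, #|cluster_of j| = 0%N -> w j = 0.
Hypothesis w_bounds : forall j,
  #|cluster_of j|%:R <= w j <= (1 + eps / 2) * #|cluster_of j|%:R.
Hypothesis D0_sat : satisfies J D0.
Hypothesis D0_opt : (\sum_(x in pts J) hamming x (tnth D0 (s x)))%N = OPT J.
Hypothesis move_small :
  (\sum_(x in pts J) hamming x (pr x))%:R <= eps / 16 * (OPT J)%:R.

Lemma tau_gt0 : (0 < tau)%N.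
Proof.
have e0 : 0 < eps by case/andP: eps_bounds.
rewrite -(ltr0n R); apply: lt_le_trans tau_big; apply: divr_gt0; last exact: exprn_gt0.
exact: mulr_gt0 (ltr0Sn _ _) (ltr0Sn _ _).
Qed.

Lemma w_ge0 j : 0 <= w j.
Proof. by have /andP[+ _] := w_bounds j; apply: le_trans. Qed.

Lemma mean_bounds i j : 0 <= mean i j <= 1.
Proof.
rewrite /mean divr_ge0 ?ler0n ?sumr_ge0 //=.
have [->|n0] := posnP #|cluster_of j|; first by rewrite invr0 mulr0 ler01.
rewrite ler_pdivrMr ?ltr0n // mul1r -sum1_card natr_sum ler_sum // => x _.
by case: (tnth _ _).
Qed.

Lemma nth_sample_family T j : (0 < #|cluster_of j|)%N ->
  nth [::] (sample_family T) j = map pr (T j).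
Proof. by move=> n0; rewrite (nth_map j) ?size_enum_ord// nth_ord_enum n0. Qed.

Lemma nth_weight_seq (j : 'I_k) : weight_seq`_j = w j.
Proof. by rewrite (nth_map j) ?size_enum_ord// nth_ord_enum. Qed.

Lemma flip_cost_sample T i b :
  (forall j, (0 < #|cluster_of j|)%N -> size (T j) = tau) ->
  flip_cost (sample_family T) weight_seq i b =
  tau%:R * \sum_j w j * bitcost (sample_mean i (T j)) (tnth b j).
Proof.
move=> sT; rewrite mulr_sumr; apply: eq_bigr => j _; rewrite nth_weight_seq.
have [n0|n0] := posnP #|cluster_of j|; first by rewrite w_empty // !mul0r mulr0.
rewrite nth_sample_family // mulrCA; congr (_ * _).
rewrite -(@sum_bitcost _ _ (T j) xpredT (fun x => tnth (pr x) i)).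
- by rewrite count_map -sum1_count big_mkcond natr_sum; apply: eq_bigr => x _ /=; case: ifP.
- by rewrite (eq_bigr (fun=> 1%:R)) // -natr_sum sum1_size sT.
- by rewrite pnatr_eq0 -lt0n tau_gt0.
Qed.

(** The chosen columns depend on the sample, but the squared deviations on the right do not depend
    on the columns, so no union bound over columns is needed. *)
Lemma best_deviation T D l : 0 < l ->
  (forall j, (0 < #|cluster_of j|)%N -> size (T j) = tau) ->
  best_for J (sample_family T) weight_seq D ->
  (1 - l) * weighted_cost D <=
  (1 + l) * weighted_cost D0 + (\sum_j cluster_deviation j (T j)) / l.
Proof.
move=> l0 sT HD.
rewrite /cluster_deviation (eq_bigr _ (fun j _ => mulr_sumr _ _ _ _)).
rewrite exchange_big /= mulr_suml !mulr_sumr -big_split; apply: ler_sum => i _ /=.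
have D0i : column D0 i \in rels J i by have /forallP := D0_sat; apply.
have [_ /(_ _ D0i)] := HD i (ex_intro (fun b => b \in rels J i) _ D0i).
rewrite !flip_cost_sample // ler_pM2l ?ltr0n ?tau_gt0 //.
set G := \sum_j _; set G0 := \sum_j _ => GG0.
have H : \sum_j w j * ((bitcost (mean i j) (tnth (column D i) j) -
     bitcost (mean i j) (tnth (column D0 i) j)) -
   (bitcost (sample_mean i (T j)) (tnth (column D i) j) -
    bitcost (sample_mean i (T j)) (tnth (column D0 i) j))) <=
  \sum_j w j * (l * (bitcost (mean i j) (tnth (column D i) j) +
     bitcost (mean i j) (tnth (column D0 i) j)) +
     (sample_mean i (T j) - mean i j) ^+ 2 / l).
  by apply: ler_sum => j _; rewrite ler_wpM2l ?w_ge0 // bitcost_deviation // mean_bounds.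
move: H; rewrite (eq_bigr _ (fun j _ => mulrBr _ _ _)) sumrB.
rewrite (eq_bigr _ (fun j _ => mulrBr _ _ _)) sumrB.
rewrite [X in _ - X](eq_bigr _ (fun j _ => mulrBr _ _ _)) sumrB -/G -/G0.
rewrite (eq_bigr _ (fun j _ => mulrDr _ _ _)) big_split /=.
rewrite (eq_bigr _ (fun j _ => mulrCA _ _ _)) -mulr_sumr.
rewrite (eq_bigr _ (fun j _ => mulrDr _ _ _)) big_split /=.
rewrite [X in _ <= _ + X -> _](eq_bigr _ (fun j _ => mulrA _ _ _)) -mulr_suml.
move: (\sum_j _) (\sum_j _) (\sum_j _) => a b c.
lra.
Qed.

Lemma moved_costE D : (moved_cost D)%:R =
  \sum_i \sum_j #|cluster_of j|%:R * bitcost (mean i j) (tnth (column D i) j).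
Proof.
rewrite /moved_cost /hamming exchange_big natr_sum; apply: eq_bigr => i _ /=.
rewrite natr_sum (partition_big s xpredT) //=; apply: eq_bigr => j _.
have [n0|n0] := posnP #|cluster_of j|.
  rewrite n0 mul0r big_pred0 // => x; have := card0_eq n0 x.
  by rewrite !inE.
rewrite -(@sum_bitcost _ _ _ _ (fun x => tnth (pr x) i)) ?pnatr_eq0 -?lt0n //.
  apply: eq_big => [x|x /andP[_ /eqP ->]]; first by rewrite inE.
  by rewrite tnth_mktuple.
by rewrite -sum1_card natr_sum.
Qed.

Lemma moved_cost_le D : (moved_cost D)%:R <= weighted_cost D.
Proof.
rewrite moved_costE; apply: ler_sum => i _; apply: ler_sum => j _.
by rewrite ler_wpM2r ?bitcost_ge0 ?mean_bounds //; case/andP: (w_bounds j).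
Qed.

Lemma weighted_cost_le D : weighted_cost D <= (1 + eps / 2) * (moved_cost D)%:R.
Proof.
rewrite moved_costE mulr_sumr; apply: ler_sum => i _; rewrite mulr_sumr.
apply: ler_sum => j _; rewrite mulrA ler_wpM2r ?bitcost_ge0 ?mean_bounds //.
by case/andP: (w_bounds j).
Qed.

Lemma weighted_cost_ge0 D : 0 <= weighted_cost D.
Proof. by apply: le_trans (moved_cost_le D). Qed.

Lemma good_sample_cost T D :
  (forall j, (0 < #|cluster_of j|)%N -> size (T j) = tau) ->
  \sum_j cluster_deviation j (T j) <= 8 * (weighted_cost D0 / tau%:R) ->
  best_for J (sample_family T) weight_seq D ->
  (cost J D)%:R <= (1 + eps) * (OPT J)%:R.
Proof.
move=> sT dev HD; have [e0 e1] := andP eps_bounds.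
set mv := (\sum_(x in pts J) hamming x (pr x))%N.
have cD : (cost J D)%:R <= mv%:R + (moved_cost D)%:R :> R.
  rewrite -natrD ler_nat -big_split; apply: leq_sum => x _.
  apply: leq_trans (hamming_triangle x (pr x) _).
  by apply: dist_to_le; rewrite inE mem_tnth.
have cD0 : (moved_cost D0)%:R <= mv%:R + (OPT J)%:R :> R.
  rewrite -D0_opt -natrD ler_nat /mv -big_split; apply: leq_sum => x _ /=.
  by rewrite (hammingC x (pr x)) hamming_triangle.
have := @best_deviation T D (eps / 128) _ sT HD.
have := moved_cost_le D; have := weighted_cost_le D0.
have G0 := weighted_cost_ge0 D0; have G := weighted_cost_ge0 D.
(* With 8 from Markov's inequality, 8 * 128 / (eps * tau) <= eps / 64 amounts to tau >= 256^2 /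
   eps^2. *)
have dev' : (\sum_j cluster_deviation j (T j)) / (eps / 128) <= eps / 64 * weighted_cost D0.
  rewrite ler_pdivrMr ?divr_gt0 //; apply: le_trans dev _.
  rewrite mulrA ler_pdivrMr ?ltr0n ?tau_gt0 //.
  have := tau_big; rewrite ler_pdivrMr ?exprn_gt0 // => tb.
  have -> : eps / 64 * weighted_cost D0 * (eps / 128) * tau%:R =
    (tau%:R * eps ^+ 2) * (weighted_cost D0 / (64 * 128)) by field.
  by apply: le_trans (ler_wpM2r _ tb); lra.
move=> H1 H2 H3; apply: (cost_arith e0 e1 cD cD0 move_small H2 H1 dev' _ G0).
- by apply: H3; rewrite divr_gt0.
- by [].
Qed.


(** * The idealised sample, uniform on each cluster *)

Section Sampling.
Variables (r : R) (N : nat).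
Hypotheses (r_ge0 : 0 <= r) (r_small : r * k%:R < 1).
Hypothesis N_big : k%:R * expR (tau%:R - r * N%:R / 2) <= 1 / 8.

Definition cluster_law (j : 'I_k) (x : bpoint d) : R :=
  (x \in cluster_of j)%:R / #|cluster_of j|%:R.

Lemma cluster_law_ge0 j x : 0 <= cluster_law j x.
Proof. by rewrite divr_ge0. Qed.

Lemma sum_cluster_law j (f : bpoint d -> R) :
  \sum_x cluster_law j x * f x = (\sum_(x in cluster_of j) f x) / #|cluster_of j|%:R.
Proof.
rewrite mulr_suml [RHS]big_mkcond; apply: eq_bigr => x _ /=; rewrite /cluster_law.
by case: ifP => _; rewrite ?mul0r // mul1r mulrC.
Qed.

Lemma cluster_law_sum1 j : (0 < #|cluster_of j|)%N -> \sum_x cluster_law j x = 1.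
Proof.
move=> n0; transitivity (\sum_x cluster_law j x * 1).
  by apply: eq_bigr => x _; rewrite mulr1.
rewrite sum_cluster_law (eq_bigr (fun=> 1%:R)) // -natr_sum sum1_card.
by rewrite divff // pnatr_eq0 -lt0n.
Qed.

(** The mean of [tau] independent bits has variance p(1 - p)/tau, and p(1 - p) is at most both p and
    1 - p, hence at most the cost of either bit. *)
Lemma Ex_cluster_deviation j : (0 < #|cluster_of j|)%N ->
  Ex (cluster_law j) tau (cluster_deviation j) <=
  w j * (\sum_i bitcost (mean i j) (tnth (column D0 i) j)) / tau%:R.
Proof.
move=> n0; have t0 : 0 < tau%:R :> R by rewrite ltr0n tau_gt0.
rewrite ExZ Ex_sum -mulrA ler_wpM2l ?w_ge0 // mulr_suml; apply: ler_sum => i _.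
pose a (x : bpoint d) : R := (tnth (pr x) i)%:R.
have Ea : \sum_x cluster_law j x * a x = mean i j by rewrite sum_cluster_law.
pose h x := a x - mean i j.
have h0 : \sum_x cluster_law j x * h x = 0.
  rewrite (eq_bigr _ (fun x _ => mulrBr _ _ _)) sumrB Ea -mulr_suml.
  by rewrite cluster_law_sum1 // mul1r subrr.
have h2 : \sum_x cluster_law j x * h x ^+ 2 = mean i j * (1 - mean i j).
  (* A bit equals its square, so the squared deviation is affine in [a x]. *)
  rewrite (eq_bigr (fun x => (1 - 2 * mean i j) * (cluster_law j x * a x) +
      cluster_law j x * mean i j ^+ 2)); last first.
    by move=> x _; rewrite /h /a; case: (tnth _ _) => /=; ring.
  rewrite big_split /= -mulr_sumr Ea -mulr_suml cluster_law_sum1 //; ring.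
apply: (@le_trans _ _ (Ex (cluster_law j) tau
    (fun T => tau%:R ^- 2 * (0 + \sum_(x <- T) h x) ^+ 2))).
  apply: Ex_le => [x|T sT]; first exact: cluster_law_ge0.
  rewrite add0r sumrB big_const_seq count_predT iter_addr_0 sT -exprVn -exprMn.
  by rewrite mulrBr -[mean i j *+ _]mulr_natl mulKf ?gt_eqF // mulrC.
rewrite ExZ (Ex_sqr_sum (cluster_law_sum1 n0) _ _ h0 h2) expr0n add0r.
rewrite expr2 invfM -mulrA mulKf ?gt_eqF // mulrC ler_wpM2r ?invr_ge0 ?ler0n //.
have := mean_bounds i j; rewrite /bitcost.
by move: (mean i j) => m /andP[m0 m1]; case: (tnth _ _); nra.
Qed.

Definition sampling_mass (x : bpoint d) : R :=
  if x \in pts J then r / #|cluster_of (s x)|%:R else 0.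

(** [None] takes the mass left over by the clusters; the coupling needs it to be positive. *)
Definition sampling_law (y : option (bpoint d)) : R :=
  if y is Some x then sampling_mass x else 1 - \sum_x sampling_mass x.

Lemma sampling_mass_le : \sum_x sampling_mass x <= r * k%:R.
Proof.
rewrite -big_mkcond /= (partition_big s xpredT) //=.
apply: (@le_trans _ _ (\sum_(j < k) r)); last first.
  by rewrite sumr_const card_ord mulr_natr.
apply: ler_sum => j _.
rewrite (_ : bigop _ _ _ = \sum_(x in cluster_of j) r / #|cluster_of j|%:R); last first.
  by apply: eq_big => [x|x /andP[_ /eqP ->]]; rewrite ?inE.
rewrite sumr_const -[_ *+ #|_|]mulr_natr.
have [->|n0] := posnP #|cluster_of j|; first by rewrite mulr0.
by rewrite divfK // pnatr_eq0 -lt0n.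
Qed.

Lemma sampling_law_None : 0 < sampling_law None.
Proof. by rewrite subr_gt0 (le_lt_trans sampling_mass_le). Qed.

Lemma sampling_law_ge0 y : 0 <= sampling_law y.
Proof.
case: y => [x|]; last exact/ltW/sampling_law_None.
by rewrite /= /sampling_mass; case: ifP => // _; rewrite divr_ge0.
Qed.

Lemma sampling_law_sum1 : \sum_y sampling_law y = 1.
Proof. by rewrite big_option /= subrK. Qed.

Lemma sampling_law_cluster j x : x \in cluster_of j ->
  sampling_law (Some x) = r * cluster_law j x.
Proof.
move=> xj; rewrite /= /sampling_mass /cluster_law xj mul1r.
by move: xj; rewrite inE => /andP[-> /eqP ->].
Qed.

Lemma cluster_law_out j x : x \notin cluster_of j -> cluster_law j x = 0.
Proof. by move=> /negPf xj; rewrite /cluster_law xj mul0r. Qed.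

Definition cluster_sample (ys : seq (option (bpoint d))) (j : 'I_k) :=
  take tau (hits (fun x => x \in cluster_of j) ys).

(** Clusters with too few hits contribute 0, so that each term has the form bounded by
    [Ex_first_hits]. *)
Definition total_deviation ys : R :=
  \sum_j (tau <= size (hits (fun x => x \in cluster_of j) ys))%N%:R *
          cluster_deviation j (cluster_sample ys j).

Definition good_sample ys : bool :=
  [forall j, (0 < #|cluster_of j|)%N ==>
             (tau <= size (hits (fun x => x \in cluster_of j) ys))%N]
  && (total_deviation ys <= 8 * (weighted_cost D0 / tau%:R)).

Lemma cluster_deviation_ge0 j T : 0 <= cluster_deviation j T.
Proof. by rewrite mulr_ge0 ?w_ge0 // sumr_ge0 // => i _; rewrite sqr_ge0. Qed.

Lemma Ex_total_deviation :
  Ex sampling_law N total_deviation <= weighted_cost D0 / tau%:R.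
Proof.
rewrite Ex_sum /weighted_cost exchange_big mulr_suml; apply: ler_sum => j _.
have [n0|n0] := posnP #|cluster_of j|.
  rewrite (eq_Ex _ _ (G := fun=> 0)) => [|ys].
    rewrite Ex0 big1 ?mul0r // => i _; by rewrite w_empty // mul0r.
  by rewrite /cluster_deviation w_empty // mul0r mulr0.
apply: le_trans (_ : Ex (cluster_law j) tau (cluster_deviation j) <= _).
  apply: (Ex_first_hits sampling_law_ge0 sampling_law_sum1 r_ge0
    (cluster_law_ge0 j) (cluster_law_sum1 n0) (@cluster_law_out j)
    (@sampling_law_cluster j) N tau (cluster_deviation_ge0 j)).
by apply: le_trans (Ex_cluster_deviation n0) _; rewrite mulr_sumr.
Qed.

Lemma good_sample_likely : 3 / 4 <= Ex sampling_law N (fun ys => (good_sample ys)%:R).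
Proof.
pose few j ys : R := (size (hits (fun x => x \in cluster_of j) ys) < tau)%N%:R.
pose big ys : R := (8 * (weighted_cost D0 / tau%:R) < total_deviation ys)%R%:R.
have H1 : Ex sampling_law N (fun ys => \sum_(j | (0 < #|cluster_of j|)%N) few j ys) <= 1 / 8.
  rewrite Ex_sum; apply: le_trans N_big; rewrite mulr_natl.
  rewrite -[X in _ *+ X]card_ord -sumr_const.
  rewrite big_mkcond; apply: ler_sum => j _; case: ifP => [n0|_]; last exact: expR_ge0.
  apply: (Ex_few_hits sampling_law_ge0 sampling_law_sum1
    (cluster_law_sum1 n0) (@cluster_law_out j) (@sampling_law_cluster j)).
  apply: le_trans (ltW r_small); rewrite ler_peMr // ler1n.
  exact: leq_ltn_trans (ltn_ord j).
have H2 : Ex sampling_law N big <= 1 / 8.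
  rewrite div1r; apply: Ex_markov Ex_total_deviation => //.
  - exact: sampling_law_ge0.
  - by move=> ys; apply: sumr_ge0 => j _; rewrite mulr_ge0 // cluster_deviation_ge0.
(* Union bound, pointwise: a sample that is not good has a nonempty cluster with too few hits or a
   large deviation. *)
have H3 : 1 <= Ex sampling_law N (fun ys => (good_sample ys)%:R +
    (\sum_(j | (0 < #|cluster_of j|)%N) few j ys + big ys)).
  rewrite -[leLHS](Ex_cst sampling_law_sum1 N).
  apply: Ex_le => [|ys _]; first exact: sampling_law_ge0.
  have few0 : 0 <= \sum_(j | (0 < #|cluster_of j|)%N) few j ys by apply: sumr_ge0.
  rewrite /good_sample /big; case: forallP => [_|nall] /=; last first.
    rewrite add0r ler_wpDr //.
    have /existsP[j] : [exists j, (0 < #|cluster_of j|)%N &&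
        (size (hits (fun x => x \in cluster_of j) ys) < tau)%N].
      apply: contraT => /existsPn H; case: nall => j; apply/implyP => n0.
      by have := H j; rewrite n0 -leqNgt.
    move=> /andP[n0 lt]; rewrite (bigD1 j) //= /few lt ler_wpDr // sumr_ge0 //.
  rewrite [total_deviation ys <= _]leNgt.
  by case: (_ < total_deviation ys) => /=; lra.
rewrite !ExD in H3; lra.
Qed.

Hypothesis pr_far : forall x, x \in pts J -> far x -> pr x = x.
Hypothesis pr_near : forall x, x \in pts J -> ~~ far x -> pr x \in B.
Hypothesis b0_in : b0 \in B.

Lemma cluster_sample_in ys j x : x \in cluster_sample ys j -> x \in cluster_of j.
Proof. by move/mem_take; rewrite mem_filter => /andP[]. Qed.

Lemma count_hits ys z j : (count_mem z (cluster_sample ys j) <= count_mem (Some z) ys)%N.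
Proof.
apply: leq_trans (leq_count_subseq _ (take_subseq _ _)) _.
apply: leq_trans (leq_count_subseq _ (filter_subseq _ _)) _.
by elim: ys => //= -[x|] ys IH //=; rewrite leq_add2l.
Qed.

(** An element outside [B] can only be a far point hit in its own cluster. An element of [B] occurs
    at most [tau] times in a group, which is why [tau * k] copies of each center suffice. *)
Lemma count_sample_family ys z (j : 'I_k) :
  (count_mem z (nth [::] (sample_family (cluster_sample ys)) j) <=
   (if s z == j then count_mem (Some z) ys * far z else 0) + tau * (z \in B))%N.
Proof.
rewrite (nth_map j) ?size_enum_ord// nth_ord_enum.
case: ifP => n0; last first.
  rewrite count_nseq /= mulnC; apply: leq_trans (leq_addl _ _).
  by rewrite leq_mul2l; case: (b0 =P z) => [<-|_]; rewrite ?b0_in ?orbT.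
case: (boolP (z \in B)) => zB.
  apply: leq_trans (count_size _ _) _; rewrite size_map muln1.
  by apply: leq_trans (leq_addl _ _); rewrite size_take; case: ltnP.
rewrite muln0 addn0 count_map.
have H x : x \in cluster_sample ys j -> pr x = z -> [/\ x = z, s z = j & far z].
  move=> /cluster_sample_in; rewrite inE => /andP[xX /eqP sx] prx.
  have fx : far x by apply: contraNT zB => /(pr_near xX); rewrite prx.
  by move: prx; rewrite pr_far // => <-.
case: (boolP ((s z == j) && far z)) => [/andP[sz fz]|nfz].
  rewrite sz fz muln1; apply: leq_trans (count_hits ys z j).
  rewrite (eq_in_count (a2 := predI (pred1 z) (preim pr (pred1 z)))) => [|x xT /=].
    by apply: sub_count => x /andP[].
  case: eqP => [prx|_]; last by rewrite andbF.
  by have [] := H x _ prx; rewrite ?fz // => ->; rewrite eqxx.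
rewrite (_ : count _ _ = 0%N) //; apply/eqP; rewrite -leqn0 leqNgt -has_count.
apply/hasPn => x xT /=; apply: contraNneq nfz => prx.
by have [_ -> ->] := H x xT prx; rewrite eqxx.
Qed.

Lemma good_sample_available ys xs :
  (forall z, far z -> count_mem (Some z) ys <= count_mem z xs)%N ->
  good_sample ys ->
  available k tau B xs (sample_family (cluster_sample ys)).
Proof.
move=> Hc /andP[/forallP hall _]; split.
- by rewrite size_map size_enum_ord.
- move=> j; rewrite (nth_map j) ?size_enum_ord// nth_ord_enum; case: ifP => n0.
    by rewrite size_map size_takel //; have := hall j; rewrite n0.
  by rewrite size_nseq.
move=> z; rewrite count_flatten -map_comp sumnE big_map big_enum /=.
apply: (@leq_trans (\sum_(j < k) ((if s z == j then count_mem (Some z) ys * far z else 0)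
    + tau * (z \in B)))%N).
  apply: leq_sum => j _; apply: leq_trans (count_sample_family ys z j).
  by rewrite /sample_family (nth_map j) ?size_enum_ord// nth_ord_enum.
rewrite big_split /= leq_add //.
  (* A point lies in one cluster only, so its hits are spent once over all groups. *)
  rewrite -big_mkcond /= (big_pred1 (s z)) => [|j]; last by rewrite eq_sym.
  by case: (boolP (far z)) => [/Hc|_]; rewrite ?muln1 ?muln0.
by rewrite sum_nat_const card_ord mulnCA mulnA.
Qed.

Lemma good_sample_cost_le ys D : good_sample ys ->
  best_for J (sample_family (cluster_sample ys)) weight_seq D ->
  (cost J D)%:R <= (1 + eps) * (OPT J)%:R.
Proof.
move=> /andP[/forallP hall dev]; apply: good_sample_cost.
  by move=> j n0; rewrite size_takel //; have := hall j; rewrite n0.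
apply: le_trans dev; apply: ler_sum => j _.
have [n0|n0] := posnP #|cluster_of j|.
  by rewrite /cluster_deviation w_empty // !mul0r mulr0.
by have := hall j; rewrite n0 /= => ->; rewrite mul1r.
Qed.

End Sampling.

End Clustering.

(** * Near and far points *)

Lemma superset_card (T : finType) (A : {set T}) m :
  (#|A| <= m <= #|T|)%N -> exists2 C : {set T}, A \subset C & #|C| = m.
Proof.
elim: m => [|m IH] in A *; first by rewrite leqn0 => /andP[/eqP A0 _]; exists A.
case: (ltngtP #|A| m.+1) => //= [lt mT|Am _]; last by exists A.
have /IH[C AC Cm] : (#|A| <= m <= #|T|)%N by rewrite -ltnS lt ltnW.
have /card_gt0P[x] : (0 < #|~: C|)%N by rewrite cardsCs finset.setCK subn_gt0 Cm.
rewrite inE => xC; exists (x |: C); first by rewrite (fintype.subset_trans AC) ?finset.subsetUr.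
by rewrite cardsU1 xC Cm.
Qed.

(** * Rounding cluster sizes to powers of 1 + eps *)

Section WeightGrid.
Variable R : realType.

Lemma ln1p_gt0 (x : R) : 0 < x -> 0 < ln (1 + x).
Proof. by move=> x0; rewrite ln_gt0 // ltrDl. Qed.

Lemma absz_ceil (x : R) : 0 <= x -> x <= `|Num.ceil x|%N%:R < x + 1.
Proof.
move=> x0; have c0 : 0 <= Num.ceil x by rewrite Num.Theory.ceil_ge0; lra.
rewrite natr_absz ger0_norm // Num.Theory.ceil_ge /=.
by have /andP[+ _] := Num.Theory.ceil_itv x; rewrite intrB; lra.
Qed.

Lemma logceil_bounds (eps : R) n : 0 < eps -> (0 < n)%N ->
  ln n%:R / ln (1 + eps) <= (logceil (1 + eps) n)%:R < ln n%:R / ln (1 + eps) + 1.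
Proof.
move=> e0 n0; apply: absz_ceil.
by apply: divr_ge0; [rewrite ln_ge0 ?ler1n|exact/ltW/ln1p_gt0].
Qed.

(** Take the least power reaching [m]: it is 1, or the previous power is below [m] and the overshoot
    is at most one factor. The range of exponents suffices because its last power reaches [n]. *)
Lemma weight_grid (eps : R) n m : 0 < eps -> (0 < m <= n)%N ->
  exists2 t, (t <= logceil (1 + eps) n)%N &
    m%:R <= (1 + eps) ^+ t <= (1 + eps) * m%:R.
Proof.
move=> e0 /andP[m0 mn]; have l0 := ln1p_gt0 e0.
have n0 : (0 < n)%N by apply: leq_trans mn.
have [L HL L_le] : exists2 L, m%:R <= (1 + eps) ^+ L & (L <= logceil (1 + eps) n)%N.
  exists (logceil (1 + eps) n) => //; apply: (@le_trans _ _ n%:R); first by rewrite ler_nat.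
  rewrite -ler_ln ?posrE ?ltr0n ?exprn_gt0 ?lnXn //; try lra.
  by have /andP[+ _] := logceil_bounds e0 n0; rewrite ler_pdivrMr // mulr_natl.
case: (ex_minnP (ex_intro (fun t => m%:R <= (1 + eps) ^+ t) L HL)) => t mt tmin.
exists t; first exact: leq_trans (tmin _ HL) L_le.
rewrite mt /=; case: t mt tmin => [|t] _ tmin.
  by rewrite expr0 -[leLHS]mulr1 ler_pM ?ler1n //; lra.
rewrite exprS ler_wpM2l //; first by lra.
rewrite leNgt; apply/negP => /ltW /tmin.
by rewrite ltnn.
Qed.

End WeightGrid.

Section NearFar.
Variables (R : realType) (d k : nat) (J : instance d k) (B : {set bpoint d}).
Variables (D0 : k.-tuple (bpoint d)) (s : bpoint d -> 'I_k) (b0 : bpoint d).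
Variables (alpha eps : R).

Local Notation cl := (cluster_of J s).

Definition Phi_cluster j : nat := (\sum_(x in cl j) dist_to B x)%N.
Definition opt_cluster j : nat := (\sum_(x in cl j) hamming x (tnth D0 j))%N.

(** Written without division, since alpha may fail to be positive when Phi(B,X) = 0; every cluster
    is then light. *)
Definition light j : bool :=
  k%:R * alpha * (Phi_cluster j)%:R <= eps / 32 * (Phi B (pts J))%:R.

Definition near_point x : bool := light (s x) ||
  ((dist_to B x)%:R * #|cl (s x)|%:R <= eps / 128 * (Phi_cluster (s x))%:R).

Definition far_point x : bool := (x \in pts J) && ~~ near_point x.

Definition nearest x : bpoint d := [arg min_(b < b0 in B) hamming x b]%N.

Definition project x : bpoint d := if far_point x then x else nearest x.

Hypothesis eps_bounds : 0 < eps <= 1 / 2.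
Hypothesis b0_in : b0 \in B.
Hypothesis B_approx : approximate_solution alpha k (pts J) B.
Hypothesis D0_opt : (\sum_(x in pts J) hamming x (tnth D0 (s x)))%N = OPT J.

Lemma nearest_in x : nearest x \in B.
Proof. by rewrite /nearest; case: arg_minnP. Qed.

Lemma hamming_nearest x : hamming x (nearest x) = dist_to B x.
Proof.
apply/eqP; rewrite eqn_leq dist_to_le ?nearest_in // andbT.
apply/leq_bigminP; split; first exact: hamming_le.
by move=> b bB; rewrite /nearest; case: arg_minnP => // y _; apply.
Qed.

Lemma sum_clusters (f : bpoint d -> nat) :
  (\sum_(x in pts J) f x = \sum_j \sum_(x in cl j) f x)%N.
Proof.
rewrite (partition_big s xpredT) //=; apply: eq_bigr => j _.
by apply: eq_bigl => x; rewrite inE.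
Qed.

Lemma sum_Phi_cluster : (\sum_j Phi_cluster j)%N = Phi B (pts J).
Proof. by rewrite /Phi sum_clusters. Qed.

Lemma sum_opt_cluster : (\sum_j opt_cluster j)%N = OPT J.
Proof.
rewrite -D0_opt sum_clusters; apply: eq_bigr => j _; apply: eq_bigr => x.
by rewrite inE => /andP[_ /eqP ->].
Qed.

(** The entries of [D0] may coincide, whereas [OPTstar] ranges over sets of exactly [k] centers.
    Padding is possible because [B] shows that the cube has at least [k] points. *)
Lemma OPTstar_le : (OPTstar k (pts J) <= OPT J)%N.
Proof.
have [C DC Ck] : exists2 C : {set bpoint d}, centers D0 \subset C & #|C| = k.
  apply: superset_card; apply/andP; split.
    by rewrite cardsE; apply: leq_trans (card_size _) _; rewrite size_tuple.
  by have := max_card (mem B); rewrite B_approx.1.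
have /leq_bigminP[_ /(_ C)] := leqnn (OPTstar k (pts J)).
rewrite Ck eqxx => /(_ isT) /leq_trans; apply.
rewrite -D0_opt; apply: leq_sum => x _; apply/dist_to_le/(fintype.subsetP DC).
by rewrite inE mem_tnth.
Qed.

(** [B] itself competes for [OPTstar], which cannot vanish without forcing the cost of [B] to
    vanish. *)
Lemma alpha_ge1 : (0 < Phi B (pts J))%N -> 1 <= alpha.
Proof.
move=> A0; have [cB ApB] := B_approx.
have /leq_bigminP[_ /(_ B)] := leqnn (OPTstar k (pts J)).
rewrite cB eqxx => /(_ isT) O_le.
have O0 : (0 < OPTstar k (pts J))%N.
  rewrite lt0n; apply: contraTneq ApB => ->.
  by rewrite mulr0 -ltNge ltr0n.
rewrite -(@ler_pM2r _ (OPTstar k (pts J))%:R) ?ltr0n // mul1r.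
by apply: le_trans ApB; rewrite ler_nat.
Qed.

(** Near distances are small against the cost of [B] on the cluster, which may far exceed the
    optimal one. But the center nearest to a near point serves the whole cluster, so many near
    points force the cost of [B] down; averaging over them gives the comparison. *)
Lemma near_sum_le j : ~~ light j ->
  (\sum_(x in cl j | ~~ far_point x) dist_to B x)%:R <=
  eps / 32 * (opt_cluster j)%:R :> R.
Proof.
move=> nlight; have [e0 e1] := andP eps_bounds.
have [n0|n0] := posnP #|cl j|.
  rewrite big_pred0; first by rewrite mulr_ge0 // divr_ge0 // ltW.
  by move=> x; rewrite (card0_eq n0).
pose P x := (x \in cl j) && ~~ far_point x.
have nearP x : P x -> (dist_to B x)%:R * #|cl j|%:R <= eps / 128 * (Phi_cluster j)%:R.
  rewrite /P /far_point inE => /andP[/andP[-> /eqP sx]] /=.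
  by rewrite negbK /near_point sx (negPf nlight).
set n : R := #|cl j|%:R in nearP *.
have n_gt0 : 0 < n by rewrite ltr0n.
set phi : R := (Phi_cluster j)%:R in nearP *; set o : R := (opt_cluster j)%:R.
have phi0 : 0 <= phi by [].
(* Every y of the cluster reaches the center nearest to x through the optimal center and x. *)
have key x : P x -> (1 - eps / 128) * phi <= o + n * (hamming x (tnth D0 j))%:R.
  move=> Px; have : (Phi_cluster j <= opt_cluster j + #|cl j| * hamming x (tnth D0 j)
      + dist_to B x * #|cl j|)%N.
    rewrite -addnA [(dist_to B x * _)%N]mulnC -mulnDr -sum_nat_const -big_split.
    apply: leq_sum => y _; rewrite -(hamming_nearest x).
    apply: leq_trans (dist_to_le y (nearest_in x)) _.
    apply: leq_trans (hamming_triangle y (tnth D0 j) _) _; rewrite leq_add2l.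
    by rewrite (hammingC x); apply: hamming_triangle.
  by rewrite -(ler_nat R) !natrD !natrM -/n -/phi -/o; have := nearP x Px; lra.
pose m : R := \sum_(x | P x) 1.
have mn : m <= n.
  rewrite /m /n -sum1_card natr_sum [leRHS](bigID far_point) /= addrC.
  by rewrite lerDl sumr_ge0.
have m0 : 0 <= m by apply: sumr_ge0.
have sumH : \sum_(x | P x) (hamming x (tnth D0 j))%:R <= o.
  rewrite /o natr_sum [leRHS](bigID far_point) /= addrC lerDl.
  by apply: sumr_ge0.
have H1 : m * ((1 - eps / 128) * phi) <= m * o + n * o.
  apply: (@le_trans _ _ (\sum_(x | P x) (o + n * (hamming x (tnth D0 j))%:R))).
    by rewrite /m mulr_suml; apply: ler_sum => x /key; rewrite mul1r.
  rewrite big_split /= -mulr_sumr lerD //; last by rewrite ler_pM2l.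
  by rewrite /m mulr_suml; apply: ler_sum => x _; rewrite mul1r.
have H2 : (\sum_(x | P x) dist_to B x)%:R * n <= m * (eps / 128 * phi).
  rewrite natr_sum mulr_suml /m mulr_suml; apply: ler_sum => x /nearP.
  by rewrite mul1r.
have o0 : 0 <= o by [].
rewrite -(ler_pM2r n_gt0); apply: le_trans H2 _.
have H3 : m * o <= n * o by rewrite ler_wpM2r.
(* The sum of [key] over the near points gives m (1 - eps/128) phi <= 2 n o, and the factor on the
   left is at least 1/2. *)
have H4 : m * phi <= 4 * (n * o).
  have mphi : 0 <= m * phi by rewrite mulr_ge0.
  have : eps / 128 * (m * phi) <= 1 / 2 * (m * phi) by rewrite ler_wpM2r //; lra.
  by move: H1; rewrite mulrCA; lra.
have := ler_wpM2l (ltW e0) H4; lra.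
Qed.

Lemma light_sum_le : \sum_(j | light j) (Phi_cluster j)%:R <= eps / 32 * (OPT J)%:R.
Proof.
have [e0 e1] := andP eps_bounds.
have [A0|A0] := posnP (Phi B (pts J)).
  rewrite big1 => [|j _]; first by rewrite mulr_ge0 // divr_ge0 // ltW.
  have : (Phi_cluster j <= 0)%N by rewrite -A0 -sum_Phi_cluster (bigD1 j) //= leq_addr.
  by rewrite leqn0 => /eqP ->.
have a1 := alpha_ge1 A0; have a0 : 0 < alpha by lra.
have k0 : (0 < k)%N by rewrite -B_approx.1; apply/card_gt0P; exists b0.
have ka0 : 0 < k%:R * alpha by rewrite mulr_gt0 // ltr0n.
rewrite -(ler_pM2l ka0) mulr_sumr.
apply: (@le_trans _ _ (\sum_(j < k) eps / 32 * (Phi B (pts J))%:R)).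
  rewrite big_mkcond; apply: ler_sum => j _; case: ifP => // _.
  by rewrite mulr_ge0 // divr_ge0 // ltW.
rewrite sumr_const card_ord -[leLHS]mulr_natl.
rewrite (_ : k%:R * alpha * _ = k%:R * (eps / 32 * (alpha * (OPT J)%:R))); last by ring.
rewrite ler_pM2l ?ltr0n // ler_pM2l; last by rewrite divr_gt0.
apply: le_trans B_approx.2 _.
by rewrite ler_pM2l // ler_nat OPTstar_le.
Qed.

Lemma project_small :
  (\sum_(x in pts J) hamming x (project x))%:R <= eps / 16 * (OPT J)%:R :> R.
Proof.
have [e0 e1] := andP eps_bounds.
have -> : (\sum_(x in pts J) hamming x (project x) =
           \sum_j \sum_(x in cl j | ~~ far_point x) dist_to B x)%N.
  rewrite sum_clusters; apply: eq_bigr => j _; rewrite [RHS]big_mkcondr /=.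
  apply: eq_bigr => x _; rewrite /project; case: ifP => _ /=.
    exact: hamming_refl.
  exact: hamming_nearest.
rewrite natr_sum (bigID light) /=.
have H1 : \sum_(j | light j) (\sum_(x in cl j | ~~ far_point x) dist_to B x)%:R
    <= eps / 32 * (OPT J)%:R :> R.
  apply: le_trans light_sum_le; apply: ler_sum => j _; rewrite ler_nat.
  by rewrite /Phi_cluster [leqRHS](bigID far_point) /= leq_addl.
have H2 : \sum_(j | ~~ light j) (\sum_(x in cl j | ~~ far_point x) dist_to B x)%:R
    <= eps / 32 * (OPT J)%:R :> R.
  rewrite -sum_opt_cluster natr_sum mulr_sumr [leRHS](bigID light) /=.
  rewrite ler_wpDl //; last by apply: ler_sum => j; apply: near_sum_le.
  by apply: sumr_ge0 => j _; rewrite mulr_ge0 // divr_ge0 // ltW.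
by move: H1 H2; lra.
Qed.

(** Being far gives eps/128 of the mean distance, a heavy cluster eps/(32 alpha k) of the total
    cost, and 128 * 32 = 64 * 64. *)
Lemma far_likely x : far_point x ->
  eps ^+ 2 / (64 * 64 * alpha * k%:R) / #|cl (s x)|%:R <= D2prob R J B x.
Proof.
have [e0 e1] := andP eps_bounds.
rewrite /far_point /near_point negb_or -!ltNge => /andP[xX /andP[heavy fx]].
have A0 : (0 < Phi B (pts J))%N.
  have [A0|//] := posnP (Phi B (pts J)); move: heavy; rewrite /light A0.
  have : (Phi_cluster (s x) <= 0)%N.
    by rewrite -A0 -sum_Phi_cluster (bigD1 (s x)) //= leq_addr.
  by rewrite leqn0 => /eqP ->; rewrite mulr0n !mulr0 ltxx.
have a1 := alpha_ge1 A0; have a0 : 0 < alpha by lra.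
have k0 : (0 < k)%N by rewrite -B_approx.1; apply/card_gt0P; exists b0.
have ka0 : 0 < k%:R * alpha by rewrite mulr_gt0 // ltr0n.
have n0 : (0 < #|cl (s x)|)%N by apply/card_gt0P; exists x; rewrite inE xX eqxx.
rewrite /D2prob xX D2weightsE; rewrite eqn0Ngt A0 /=.
rewrite big_map big_enum /= -natr_sum -/(Phi B (pts J)).
rewrite ler_pdivlMr ?ltr0n // mulrAC ler_pdivrMr ?ltr0n //.
rewrite mulrAC ler_pdivrMr; last by rewrite mulr_gt0 ?ltr0n // mulr_gt0.
have : (eps / 128) * (eps / 32 * (Phi B (pts J))%:R) <=
       (eps / 128) * (k%:R * alpha * (Phi_cluster (s x))%:R).
  by rewrite ler_pM2l ?divr_gt0 // ltW.
have := ltW fx; rewrite -(ler_pM2l ka0); lra.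
Qed.

End NearFar.

(** * Success probability *)

Section Success.
Variables (R : realType) (d k : nat) (J : instance d k) (B : {set bpoint d}).
Variables (zero : bool) (alpha eps : R) (tau eta zeta : nat).

Hypothesis eps_bounds : 0 < eps <= 1 / 2.
Hypothesis k_gt0 : (0 < k)%N.
Hypothesis pts_gt0 : (0 < #|pts J|)%N.
Hypothesis B_approx : approximate_solution alpha k (pts J) B.
Hypothesis tau_big : 256 * 256 / eps ^+ 2 <= tau%:R.
Hypothesis eta_big :
  128 * 128 * (tau%:R * alpha * k%:R / eps ^+ 2) <= eta%:R.

(** The alternative on empty clusters enters here: such a cluster needs weight 0, which is listed
    only when [zero] is set. *)
Lemma weights_exist (s : bpoint d -> 'I_k) :
  zero \/ (forall j, exists2 x, x \in pts J & s x = j) ->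
  exists w : 'I_k -> R, forall j,
    [/\ #|cluster_of J s j| = 0%N -> w j = 0,
        #|cluster_of J s j|%:R <= w j <= (1 + eps / 2) * #|cluster_of J s j|%:R
      & w j = 0 /\ zero \/ exists2 t,
          (t <= logceil (1 + eps / 2) #|pts J|)%N & w j = (1 + eps / 2) ^+ t].
Proof.
pose P j (v : R) := [/\ #|cluster_of J s j| = 0%N -> v = 0,
  #|cluster_of J s j|%:R <= v <= (1 + eps / 2) * #|cluster_of J s j|%:R
  & v = 0 /\ zero \/ exists2 t,
      (t <= logceil (1 + eps / 2) #|pts J|)%N & v = (1 + eps / 2) ^+ t].
move=> zs; suff H j : exists v, P j v by have [w] := boolp.choice H; exists w.
have [n0|n0] := posnP #|cluster_of J s j|.
  exists 0; split=> //; first by rewrite n0 mulr0 lexx.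
  left; split=> //; case: zs => // /(_ j)[x xX sx].
  by have := card0_eq n0 x; rewrite inE xX sx eqxx.
have e2 : 0 < eps / 2 by rewrite divr_gt0 //; case/andP: eps_bounds.
have [|t tL Ht] := @weight_grid R (eps / 2) #|pts J| #|cluster_of J s j| e2.
  by rewrite n0 /=; apply/subset_leq_card/fintype.subsetP => x; rewrite inE => /andP[].
exists ((1 + eps / 2) ^+ t); split=> //; first by move=> e; rewrite e in n0.
by right; exists t.
Qed.

(** The bound is at most k exp(-tau k) <= k / (1 + tau k), which is below 1/tau. *)
Lemma tail_small (y : R) : 8 <= tau%:R :> R -> tau%:R * k%:R *+ 2 <= y ->
  k%:R * expR (tau%:R - y) <= 1 / 8.
Proof.
move=> t8 hy; have k1 : 1 <= k%:R :> R by rewrite ler1n.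
have tk0 : 0 <= tau%:R * k%:R :> R by rewrite mulr_ge0.
apply: (@le_trans _ _ (k%:R * expR (- (tau%:R * k%:R)))).
  rewrite ler_wpM2l // ler_expR; move: hy; rewrite mulr2n.
  have : tau%:R * 1 <= tau%:R * k%:R :> R by rewrite ler_wpM2l.
  lra.
rewrite expRN ler_pdivrMr ?expR_gt0 //.
have := expR_ge1Dx (tau%:R * k%:R : R).
have : 8 * k%:R <= tau%:R * k%:R :> R by rewrite ler_wpM2r.
lra.
Qed.

Lemma compat_count (T : finType) (far : pred T) xs ys z : far z ->
  all2 (compat far) xs ys -> (count_mem (Some z) ys <= count_mem z xs)%N.
Proof.
move=> fz; elim: xs ys => [|x xs IH] [|y ys] //= /andP[xy /IH]; apply: leq_add.
case: y xy => //= x'; case: (eqVneq (Some x') (Some z)) => // -[->].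
by rewrite fz /= => /eqP ->; rewrite eqxx.
Qed.

Definition cheap (v : nat) : bool := v%:R <= (1 + eps) * (OPT J)%:R.

Lemma prob_success : (0 < zeta)%N ->
  (exists D0 (s : bpoint d -> 'I_k), [/\ satisfies J D0,
      (\sum_(x in pts J) hamming x (tnth D0 (s x)))%N = OPT J
    & zero \/ (forall j, exists2 x, x \in pts J & s x = j)]) ->
  3 / 4 <= prob (fun o => if o is Some D then cheap (cost J D) else false)
             (GoodCenters J zero tau eta zeta B eps).
Proof.
move=> zeta0 [D0 [s [D0sat D0opt zs]]].
have [e0 e1] := andP eps_bounds; have [cB _] := B_approx.
have [w Hw] := weights_exist zs.
have /card_gt0P[b0 b0B] : (0 < #|B|)%N by rewrite cB.
have w1 j : #|cluster_of J s j| = 0%N -> w j = 0 by case: (Hw j).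
have w2 j : #|cluster_of J s j|%:R <= w j <= (1 + eps / 2) * #|cluster_of J s j|%:R.
  by case: (Hw j).
have w3 j : w j = 0 /\ zero \/ exists2 t,
    (t <= logceil (1 + eps / 2) #|pts J|)%N & w j = (1 + eps / 2) ^+ t.
  by case: (Hw j).
have tau8 : 8 <= tau%:R :> R.
  apply: le_trans tau_big; rewrite ler_pdivlMr ?exprn_gt0 //; nra.
pose far := far_point J B s alpha eps.
pose pr := project J B s b0 alpha eps.
have ms := project_small eps_bounds b0B B_approx D0opt.
have pr_far x : x \in pts J -> far x -> pr x = x by move=> _ fx; rewrite /pr /project -/far fx.
have pr_near x : x \in pts J -> ~~ far x -> pr x \in B.
  by move=> _ /negPf fx; rewrite /pr /project -/far fx nearest_in.
have mono u v : (u <= v)%N -> cheap v -> cheap u.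
  by move=> uv; apply: le_trans; rewrite ler_nat.
apply: le_trans (prob_GoodCenters zero tau eta eps k_gt0 pts_gt0 cB zeta0 mono).
pose good := good_sample J D0 s pr w tau.
pose event M0 := `[< exists S w,
     [/\ available k tau B M0 S, size w = k,
         forall j : 'I_k, w`_j = 0 /\ zero \/
           exists2 t, (t <= logceil (1 + eps / 2) #|pts J|)%N & w`_j = (1 + eps / 2) ^+ t
       & forall D, best_for J S w D -> cheap (cost J D)] >].
have good_event ys xs :
    (forall z, far z -> count_mem (Some z) ys <= count_mem z xs)%N ->
    good ys -> event xs.
  move=> Hc gys; apply/asboolP.
  exists (sample_family J s pr tau b0 (cluster_sample J s tau ys)), (weight_seq w); split.
  - exact: good_sample_available Hc gys.
  - by rewrite size_map size_enum_ord.
  - by move=> j; rewrite nth_weight_seq.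
  - by move=> D HD; apply: (good_sample_cost_le eps_bounds tau_big w1 w2 D0sat D0opt ms gys HD).
have kR : 0 < k%:R :> R by rewrite ltr0n.
(* If Phi(B,X) = 0, no point is far and any actual sample realises every good idealised one, so the
   two expectations are taken independently. *)
have [A0|A0] := posnP (Phi B (pts J)).
  have nofar z : far z = false.
    apply/negP => /andP[_]; rewrite /near_point negb_or => /andP[+ _].
    rewrite /light A0.
    have : (Phi_cluster J B s (s z) <= 0)%N.
      by rewrite -A0 -(sum_Phi_cluster J B s) (bigD1 (s z)) //= leq_addr.
    by rewrite leqn0 => /eqP ->; rewrite mulr0n !mulr0 lexx.
  (* [r] only has to be below 1/k; [N] makes r N / 2 equal to 2 tau k, as the tail bound
     requires. *)
  pose r : R := 1 / (2 * k%:R); pose N := (8 * tau * k * k)%N.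
  have r0 : 0 <= r by rewrite divr_ge0 // mulr_ge0.
  have rk : r * k%:R < 1.
    by rewrite (_ : r * k%:R = 1 / 2); [lra|rewrite /r; field; rewrite gt_eqF].
  have HN : k%:R * expR (tau%:R - r * N%:R / 2) <= 1 / 8.
    apply: tail_small => //; rewrite /r /N !natrM (_ : _ / 2 = tau%:R * k%:R *+ 2) //.
    by field; rewrite gt_eqF.
  apply: le_trans (good_sample_likely D0 pr eps_bounds tau_big w1 w2 r0 rk HN) _.
  rewrite -[leRHS](Ex_cst (sampling_law_sum1 J s r) N).
  apply: Ex_le => [y|ys _]; first exact: sampling_law_ge0.
  rewrite -[leLHS](Ex_cst (D2prob_sum1 R B pts_gt0) (eta * k)).
  apply: Ex_le => [x|xs _]; first exact: D2prob_ge0.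
  rewrite ler_nat -/(event xs) -/good.
  case: (boolP (good ys)) => // gys.
  by rewrite (@good_event ys xs) // => z; rewrite nofar.
have a1 := alpha_ge1 B_approx A0.
pose r := eps ^+ 2 / (64 * 64 * alpha * k%:R).
have a0 : 0 < alpha by lra.
have ak : 0 < 64 * 64 * alpha * k%:R by rewrite !mulr_gt0.
have r0 : 0 <= r by rewrite divr_ge0 ?sqr_ge0 // ltW.
have rk : r * k%:R < 1.
  rewrite (_ : r * k%:R = eps ^+ 2 / (64 * 64 * alpha)); last first.
    by rewrite /r; field; rewrite !gt_eqF.
  by rewrite ltr_pdivrMr ?mulr_gt0 //; nra.
(* With r = eps^2 / (4096 alpha k), the constant 128 * 128 in [eta_big] is what yields r eta k / 2
   >= 2 tau k. *)
have HN : k%:R * expR (tau%:R - r * (eta * k)%:R / 2) <= 1 / 8.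
  apply: tail_small => //; rewrite /r natrM.
  have := eta_big; rewrite -(@ler_pM2r _ (eps ^+ 2 / (64 * 64 * 2 * alpha))); last first.
    by rewrite divr_gt0 ?exprn_gt0 // !mulr_gt0.
  have -> : 128 * 128 * (tau%:R * alpha * k%:R / eps ^+ 2) * (eps ^+ 2 / (64 * 64 * 2 * alpha))
    = tau%:R * k%:R *+ 2 :> R by field; rewrite !gt_eqF.
  have -> : eps ^+ 2 / (64 * 64 * alpha * k%:R) * (eta%:R * k%:R) / 2 =
    eta%:R * (eps ^+ 2 / (64 * 64 * 2 * alpha)) by field; rewrite !gt_eqF.
  by [].
apply: le_trans (good_sample_likely D0 pr eps_bounds tau_big w1 w2 r0 rk HN) _.
apply: (coupling (far := far)).
- by move=> x; apply: D2prob_ge0.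
- exact: sampling_law_ge0.
- exact: D2prob_sum1.
- exact: sampling_law_sum1.
- move=> x fx; have xX : x \in pts J by case/andP: (fx).
  have := far_likely eps_bounds b0B B_approx fx.
  by rewrite /= /sampling_mass xX.
- exact: sampling_law_None.
move=> xs ys _ xy; rewrite ler_nat -/(event xs) -/good.
case: (boolP (good ys)) => // gys.
by rewrite (@good_event ys xs) // => z fz; apply: compat_count xy.
Qed.

End Success.

Lemma OPT_attained d k (J : instance d k) (zero : bool) :
  (0 < k)%N -> feasible J -> zero \/ optimal_clusters_nonempty J ->
  exists D0 (s : bpoint d -> 'I_k), [/\ satisfies J D0,
      (\sum_(x in pts J) hamming x (tnth D0 (s x)))%N = OPT J
    & zero \/ (forall j, exists2 x, x \in pts J & s x = j)].
Proof.
move=> k0 fJ [z|[D [s [Ds Dopt Dne]]]]; last by exists D, s; split=> //; right.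
have [D1 D1s] := fJ.
(* The unit of the minimum defining [OPT] must not undercut the costs for the minimum to be
   attained. *)
have cost_le D : (Phi (centers D) (pts J) <= #|pts J| * d)%N.
  rewrite -sum_nat_const; apply: leq_sum => x _.
  by have /leq_bigminP[] := leqnn (dist_to (centers D) x).
have [D Ds DO] : exists2 D, satisfies J D & Phi (centers D) (pts J) = OPT J.
  case: (arg_minnP (fun D : k.-tuple (bpoint d) => Phi (centers D) (pts J)) D1s) => D Ds Dmin.
  exists D => //; apply/eqP; rewrite eqn_leq; apply/andP; split.
    by apply/leq_bigminP.
  by have /leq_bigminP[_] := leqnn (OPT J); apply.
pose j0 := Ordinal k0.
pose s x := [arg min_(j < j0) hamming x (tnth D j)]%N.
exists D, s; split=> //; last by left.
rewrite -DO; apply: eq_bigr => x _; apply/eqP; rewrite eqn_leq; apply/andP; split.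
  apply/leq_bigminP; split; first exact: hamming_le.
  move=> c; rewrite inE => /tnthP[j ->]; rewrite /s; case: arg_minnP => // i _.
  exact.
by apply: dist_to_le; rewrite inE mem_tnth.
Qed.

(** * Running time *)

(* [P] stands for [W ^ k], [S] for [m.+1 ^ (tau * k)]. *)
Lemma time_arith n d k W P S m tau zeta ek K :
  (0 < n)%N -> (0 < d)%N -> (0 < k)%N -> (0 < W)%N -> (W <= P)%N ->
  (ek <= m)%N -> (0 < S)%N -> (S <= K ^ (tau * k))%N ->
  (m + tau + k + zeta + 2 <= K)%N ->
  (n * (k * d.+1 + 3) + (W + (2 * k * P +
   (zeta * (ek * n.+1 + (k * (tau * k).+1 + (5 * k * (m.+1 * S) +
     S * (P * (d * (k * tau.+1 + 2 ^ k * k.+1 + 1) + k * d).+1).+1))).+1 +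
    (zeta * (S * P)) * (n * (k * d.+1).+1).+1))) <=
  27 * (n * d * P * K ^ (tau * k + k + 4)))%N.
Proof.
move=> n0 d0 k0 W0 WP ekm S0 SK KK.
have P0 : (0 < P)%N by apply: leq_trans WP.
have K2 : (2 <= K)%N by lia.
have K0 : (0 < K)%N by lia.
(* The bound 2^k on the size of a relation is absorbed by K^k. *)
have := leq_expn2r k K2; have : (0 < 2 ^ k)%N by rewrite expn_gt0.
move: (2 ^ k)%N => B B0.
rewrite !expnD; have : (0 < K ^ (tau * k))%N by rewrite expn_gt0 K0.
move: (K ^ (tau * k))%N SK => Q SQ Q0.
have : (0 < K ^ k)%N by rewrite expn_gt0 K0.
move: (K ^ k)%N => T T0 BT.
set U := (n * d * P * (Q * T * K ^ 4))%N.
have U0 : (0 < U)%N by rewrite !muln_gt0 n0 d0 P0 Q0 T0 K0.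
have kK : (k.+1 <= K)%N by lia.
have tK : (tau.+1 <= K)%N by lia.
have mK : (m.+1 <= K)%N by lia.
have zK : (zeta <= K)%N by lia.
have eK : (ek <= K)%N by lia.
have pos := (muln_gt0, n0, d0, P0, Q0, T0, K0).
(* Each stage is bounded by a multiple of a monomial dividing [U]; the coefficients 5 + 1 + 2 + 2 +
   1 + 5 + 6 + 1 + 4 add up to 27. *)
have dvd a b : (0 < b)%N -> (a * b)%N = U -> (a <= U)%N.
  by move=> b0 <-; rewrite leq_pmulr.
have M1 : (n * d * K <= U)%N by apply: (dvd _ (P * Q * T * K ^ 3)%N); [by rewrite ?(pos, expn_gt0)|rewrite /U; ring].
have M2 : (K * P <= U)%N by apply: (dvd _ (n * d * Q * T * K ^ 3)%N); [by rewrite ?(pos, expn_gt0)|rewrite /U; ring].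
have M3 : (n * K * K <= U)%N by apply: (dvd _ (d * P * Q * T * K ^ 2)%N); [by rewrite ?(pos, expn_gt0)|rewrite /U; ring].
have M4 : (K * K * K * K <= U)%N by apply: (dvd _ (n * d * P * Q * T)%N); [by rewrite ?(pos, expn_gt0)|rewrite /U; ring].
have M5 : (K * K * K * Q <= U)%N by apply: (dvd _ (n * d * P * T * K)%N); [by rewrite ?(pos, expn_gt0)|rewrite /U; ring].
have M6 : (Q * P * d * T * K * K * K <= U)%N by apply: (dvd _ (n * K)%N); [by rewrite ?(pos, expn_gt0)|rewrite /U; ring].
have M7 : (K * Q * P * n * d * K <= U)%N by apply: (dvd _ (T * K * K)%N); [by rewrite ?(pos, expn_gt0)|rewrite /U; ring].
have T1 : (n * (k * d.+1 + 3) <= 5 * (n * d * K))%N.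
  have -> : (5 * (n * d * K) = n * (5 * (d * K)))%N by ring.
  rewrite leq_mul2l; apply/orP; right.
  have : (k * d <= d * K)%N by rewrite mulnC leq_mul2l ltnW ?orbT.
  have : (1 * K <= d * K)%N by rewrite leq_mul2r d0 orbT.
  by rewrite mulnS; lia.
have T2 : (W <= U)%N.
  apply: leq_trans M2; apply: leq_trans WP _; exact: leq_pmull.
have T3 : (2 * k * P <= 2 * (K * P))%N.
  by rewrite -mulnA leq_mul2l leq_mul2r ltnW ?orbT.
have T4 : (zeta * (ek * n.+1) <= 2 * (n * K * K))%N.
  apply: (@leq_trans (K * (K * (2 * n)))%N); last by apply: eq_leq; ring.
  by rewrite !leq_mul //; lia.
have T5 : (zeta * (k * (tau * k).+1) <= K * K * K * K)%N.
  apply: (@leq_trans (K * (K * (K * K)))%N); last by apply: eq_leq; ring.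
  rewrite !leq_mul //; first lia.
  apply: leq_trans (_ : tau.+1 * k <= _)%N; first by rewrite mulSn; lia.
  by rewrite leq_mul //; lia.
have T6 : (zeta * (5 * k * (m.+1 * S)) <= 5 * (K * K * K * Q))%N.
  apply: (@leq_trans (K * (5 * K * (K * Q)))%N); last by apply: eq_leq; ring.
  by rewrite !leq_mul //; lia.
have T7 : (zeta * (S * (P * (d * (k * tau.+1 + B * k.+1 + 1) + k * d).+1).+1) <=
     6 * (Q * P * d * T * K * K * K))%N.
  apply: (@leq_trans (K * (Q * (P * (d * (6 * (T * (K * K)))))))%N); last by apply: eq_leq; ring.
  rewrite !leq_mul //.
  have H1 : (k * tau.+1 <= T * (K * K))%N.
    by rewrite -[(k * _)%N]mul1n !leq_mul //; lia.
  have H2 : (B * k.+1 <= T * (K * K))%N.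
    by rewrite leq_mul // (leq_trans kK) // leq_pmulr.
  have H3 : (1 <= T * (K * K))%N by rewrite !muln_gt0 T0 K0.
  have H4 : (k <= T * (K * K))%N.
    by rewrite -[k]mul1n leq_mul // -[k]muln1 leq_mul //; lia.
  move: H1 H2 H3 H4; move: (k * tau.+1)%N (B * k.+1)%N (T * (K * K))%N => a b c H1 H2 H3 H4.
  have H5 : (d * (a + b + 1) + k * d <= d * (4 * c))%N.
    by rewrite [(k * d)%N]mulnC -mulnDr leq_mul2l; apply/orP; right; lia.
  have H6 : (1 * 1 <= d * c)%N by rewrite leq_mul.
  have H7 : ((d * (a + b + 1) + k * d).+1 <= d * (5 * c))%N by lia.
  have H8 : (1 <= P * (d * c))%N by rewrite muln_gt0 P0.
  apply: (@leq_trans (P * (d * (5 * c)) + P * (d * c))%N).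
    by rewrite -addn1 leq_add // leq_mul.
  by rewrite -!mulnDr leq_mul // leq_mul //; lia.
have T8 : (zeta * 1 <= U)%N.
  rewrite muln1; apply: leq_trans zK _; apply: leq_trans M2.
  exact: leq_pmulr.
have T9 : (zeta * (S * P) * (n * (k * d.+1).+1).+1 <= 4 * (K * Q * P * n * d * K))%N.
  apply: (@leq_trans ((K * (Q * P)) * (n * (4 * (d * K))))%N); last by apply: eq_leq; ring.
  rewrite !leq_mul //.
  have : (k * d <= d * K)%N by rewrite mulnC leq_mul2l ltnW ?orbT.
  have : (1 * K <= d * K)%N by rewrite leq_mul2r d0 orbT.
  rewrite [(k * d.+1)%N]mulnS; move: (d * K)%N (k * d)%N => a b H1 H2.
  have H3 : (n * (k + b).+1 <= n * (3 * a))%N by rewrite leq_mul //; lia.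
  have H4 : (1 * 1 <= n * a)%N by rewrite leq_mul //; lia.
  apply: (@leq_trans (n * (3 * a) + n * a)%N); first by rewrite -[leqLHS]addn1; apply: leq_add H3 H4.
  by rewrite -mulnDr leq_mul //; lia.
move: T4 T5 T6 T7 T8 T9; rewrite -/U.
move: (ek * n.+1)%N (k * (tau * k).+1)%N (5 * k * (m.+1 * S))%N
  (S * (P * (d * (k * tau.+1 + B * k.+1 + 1) + k * d).+1).+1)%N
  (zeta * (S * P) * _)%N => a b c e g T4 T5 T6 T7 T8 T9.
have -> : (zeta * (a + (b + (c + e))).+1 =
  zeta * a + zeta * b + zeta * c + zeta * e + zeta * 1)%N by ring.
move: T1 T3 {SQ BT dvd kK tK mK zK eK KK}; clearbody U.
move: (n * (k * d.+1 + 3))%N (2 * k * P)%N => h l T1 T3.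
by lia.
Qed.

Lemma total_time_le (R : realType) d k (J : instance d k) (B : {set bpoint d})
    (zero : bool) tau eta zeta (eps : R) K :
  let L := logceil (1 + eps / 2) #|pts J| in
  #|B| = k -> (0 < k)%N -> (0 < d)%N -> (0 < #|pts J|)%N ->
  (pool_size k tau (eta * k) k + tau + k + zeta + 2 <= K)%N ->
  (total_time J B zero tau eta zeta eps <=
   27 * (#|pts J| * d * (zero + L.+1) ^ k * K ^ (tau * k + k + 4)))%N.
Proof.
move=> L Bk k0 d0 n0 KK; rewrite /total_time /scan_time /best_time Bk -/L.
set m := pool_size _ _ _ _ in KK *.
have W0 : (0 < zero + L.+1)%N by rewrite addnS.
have WP : (zero + L.+1 <= (zero + L.+1) ^ k)%N.
  by rewrite -[leqLHS]expn1 leq_pexp2l.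
have mK : (m.+1 <= K)%N by lia.
apply: leq_trans (time_arith n0 d0 k0 W0 WP (leq_addr _ _ : eta * k <= m)%N
   (_ : 0 < m.+1 ^ (tau * k))%N (leq_expn2r _ mK) KK).
  by rewrite [(m.+1 ^ (tau * k).+1)%N]expnS leq_add2l leq_add2r leq_addl.
by rewrite expn_gt0.
Qed.

Section ParameterBounds.
Variable R : realType.

Lemma natceil_ge (x : R) : x <= (natceil x)%:R.
Proof.
have m0 : 0 <= Num.max x 0 by rewrite le_max lexx orbT.
have /andP[+ _] := absz_ceil m0; apply: le_trans.
by rewrite le_max lexx.
Qed.

Lemma natceil_le (x y : R) : x <= y -> 0 <= y -> (natceil x)%:R <= y + 1.
Proof.
move=> xy y0; have m0 : 0 <= Num.max x 0 by rewrite le_max lexx orbT.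
have /andP[_ /ltW/le_trans] := absz_ceil m0; apply.
by rewrite lerD2r ge_max xy.
Qed.

Lemma ln2_ge : 1 / 2 <= ln 2 :> R.
Proof.
rewrite -ler_expR lnK ?posrE //.
have := expR_ge1Dx (- (1 / 2) : R); rewrite expRN => H.
have e0 : 0 < expR (1 / 2) :> R by apply: expR_gt0.
move: H; rewrite -(ler_pM2r e0) mulVf ?gt_eqF //; lra.
Qed.

Lemma ln_le_sub1 (x : R) : 0 < x -> ln x <= x - 1.
Proof. by move=> x0; have := expR_ge1Dx (ln x); rewrite lnK ?posrE //; lra. Qed.

Lemma ln_ge_half (y : R) : 2 <= y -> 1 / 2 <= ln y.
Proof.
move=> y2; apply: le_trans ln2_ge _.
by rewrite ler_ln ?posrE //; lra.
Qed.

(** The factor 2 in [c] compensates ln(k/eps) >= 1/2, which holds because k/eps >= 2. *)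
Lemma tau_param_ge c k (eps : R) : 2 * 256 * 256 = c -> 0 < eps <= 1 / 2 ->
  (0 < k)%N -> 256 * 256 / eps ^+ 2 <= (tau_param c k eps)%:R.
Proof.
move=> <-.
move=> /andP[e0 e1] k0; apply: le_trans (natceil_ge _).
have k1 : 1 <= k%:R :> R by rewrite ler1n.
have y2 : 2 <= k%:R / eps by rewrite ler_pdivlMr //; lra.
have e2 : 0 <= (eps ^+ 2)^-1 by rewrite invr_ge0 sqr_ge0.
have -> : 2 * 256 * 256 * (k%:R / eps ^+ 2 * ln (k%:R / eps)) =
  256 * 256 / eps ^+ 2 * (2 * k%:R * ln (k%:R / eps)) by ring.
apply: ler_peMr; first exact: mulr_ge0 (mulr_ge0 (ler0n _ _) (ler0n _ _)) e2.
have := ln_ge_half y2; nra.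
Qed.

Lemma weight_count_le (eps : R) n (zero : bool) : 0 < eps <= 1 / 2 -> (0 < n)%N ->
  (zero + (logceil (1 + eps / 2) n).+1)%:R <= 6 / eps * Num.max 1 (log2 n%:R).
Proof.
move=> /andP[e0 e1] n0; set M := Num.max _ _.
have M1 : 1 <= M by rewrite le_max lexx.
have lnM : ln n%:R <= M.
  have : ln n%:R / ln 2 <= M by rewrite le_max lexx orbT.
  have l2 := ln2_ge; have l21 : ln 2 <= 1 :> R by have := @ln_le_sub1 2; lra.
  rewrite ler_pdivrMr; last lra.
  by move=> /le_trans; apply; rewrite ler_piMr //; lra.
have e2 : 0 < eps / 2 by lra.
(* From ln x <= x - 1 at x = 1/(1 + eps/2). *)
have le4 : eps / 4 <= ln (1 + eps / 2).
  have := @ln_le_sub1 (1 + eps / 2)^-1; rewrite invr_gt0 lnV ?posrE; last lra.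
  move=> /(_ _)/wrap[]; first lra.
  have -> : (1 + eps / 2)^-1 - 1 = - (eps / 2 / (1 + eps / 2)) by field; lra.
  rewrite lerN2; apply: le_trans; rewrite ler_pdivlMr; last lra.
  nra.
have /andP[_ LL] := logceil_bounds e2 n0.
have lq : ln n%:R / ln (1 + eps / 2) <= 4 / eps * M.
  rewrite ler_pdivrMr; last lra.
  apply: le_trans lnM _; rewrite mulrAC ler_peMl //; first lra.
  by rewrite mulrAC ler_pdivlMr //; lra.
rewrite natrD -natr1; have z1 : zero%:R <= 1 :> R by case: zero.
(* 3 counts the weight 0, the exponent 0 and the rounding in [logceil]. *)
have h : 3 <= 2 / eps * M.
  apply: le_trans (_ : 4 * 1 <= _); first lra.
  by rewrite ler_pM // ler_pdivlMr //; lra.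
have -> : 6 / eps * M = 4 / eps * M + 2 / eps * M by ring.
lra.
Qed.


(** * Bounds on the parameters by powers of k/eps *)

Section PoolBound.
Variables (c1 c2 c3 alpha eps : R) (k : nat).
Hypotheses (c1_ge0 : 0 <= c1) (c2_ge0 : 0 <= c2) (c3_ge0 : 0 <= c3).
Hypotheses (eps_bounds : 0 < eps <= 1 / 2) (k_gt0 : (0 < k)%N).

Local Notation y := (k%:R / eps).
Local Notation tau := (tau_param c1 k eps).
Local Notation eta := (eta_param c2 tau alpha k eps).
Local Notation zeta := (zeta_param c3 eps).

Lemma ratio_ge2 : 2 <= y.
Proof.
have [e0 e1] := andP eps_bounds; have k1 : 1 <= k%:R :> R by rewrite ler1n.
by rewrite ler_pdivlMr //; lra.
Qed.

Lemma k_le_ratio : k%:R <= y.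
Proof.
have [e0 e1] := andP eps_bounds; have k1 : 1 <= k%:R :> R by rewrite ler1n.
by rewrite ler_pdivlMr // ler_piMr //; lra.
Qed.

Lemma inv_eps_le_ratio : eps^-1 <= y.
Proof.
have [e0 e1] := andP eps_bounds.
by rewrite ler_peMl ?ler1n // invr_ge0 ltW.
Qed.

Lemma k_div_sqr_le : 0 <= k%:R / eps ^+ 2 <= y ^+ 2.
Proof.
have [e0 e1] := andP eps_bounds; have k1 : 1 <= k%:R :> R by rewrite ler1n.
rewrite divr_ge0 ?sqr_ge0 //= expr_div_n ler_wpM2r ?invr_ge0 ?sqr_ge0 //.
by rewrite expr2 ler_peMl.
Qed.

Lemma ln_ratio_bounds : 1 / 2 <= ln y <= y.
Proof.
have y2 := ratio_ge2; rewrite ln_ge_half //=.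
by have := @ln_le_sub1 y; lra.
Qed.

(** A crude power of k/eps is enough, as this bound reaches the running time only through the base
    K, hence through ln K. *)
Lemma tau_param_le : tau%:R <= (c1 + 1) * y ^+ 3.
Proof.
have y2 := ratio_ge2; have /andP[q0 q1] := k_div_sqr_le.
have /andP[l0 l1] := ln_ratio_bounds.
have h : c1 * (k%:R / eps ^+ 2 * ln y) <= c1 * y ^+ 3.
  by rewrite ler_wpM2l // (exprSr y 2) ler_pM //; lra.
have c0 : 0 <= c1 * y ^+ 3 by rewrite mulr_ge0 ?exprn_ge0 //; lra.
apply: le_trans (natceil_le h c0) _; rewrite mulrDl mul1r lerD2l exprn_ege1 //; lra.
Qed.

(** Here tau k is an exponent of the running time, so the logarithm has to be kept. *)
Lemma tau_param_k_le :
  tau%:R * k%:R <= c1 * (k%:R ^+ 2 / eps ^+ 2 * ln y) + k%:R.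
Proof.
have /andP[q0 q1] := k_div_sqr_le; have /andP[l0 l1] := ln_ratio_bounds.
have h : 0 <= c1 * (k%:R / eps ^+ 2 * ln y) by rewrite mulr_ge0 // mulr_ge0 //; lra.
have := ler_wpM2r (ler0n R k) (natceil_le (lexx _) h).
by move/le_trans; apply; rewrite mulrDl mul1r lerD2r le_eqVlt; apply/orP; left; apply/eqP; ring.
Qed.

Lemma eta_param_le : eta%:R <= (c2 * (c1 + 1) * `|alpha| + 1) * y ^+ 5.
Proof.
have y2 := ratio_ge2; have /andP[q0 q1] := k_div_sqr_le.
have y0 : 0 <= y by lra.
have h : c2 * (tau%:R * alpha * k%:R / eps ^+ 2) <= c2 * (c1 + 1) * `|alpha| * y ^+ 5.
  have -> : c2 * (tau%:R * alpha * k%:R / eps ^+ 2) =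
    c2 * (tau%:R * (k%:R / eps ^+ 2) * alpha) by ring.
  have -> : c2 * (c1 + 1) * `|alpha| * y ^+ 5 =
    c2 * (((c1 + 1) * y ^+ 3) * y ^+ 2 * `|alpha|) by ring.
  rewrite ler_wpM2l //; apply: le_trans (_ : tau%:R * (k%:R / eps ^+ 2) * `|alpha| <= _).
    apply: ler_wpM2l; last exact: ler_norm.
    exact: mulr_ge0.
  by rewrite ler_wpM2r // ler_pM // tau_param_le.
have c0 : 0 <= c2 * (c1 + 1) * `|alpha| * y ^+ 5.
  by apply: mulr_ge0; [rewrite !mulr_ge0 // addr_ge0|apply: exprn_ge0].
apply: le_trans (natceil_le h c0) _; rewrite mulrDl mul1r lerD2l exprn_ege1 //; lra.
Qed.

Lemma zeta_param_le : zeta%:R <= (c3 + 1) * y.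
Proof.
have y2 := ratio_ge2.
have h : c3 / eps <= c3 * y by rewrite ler_wpM2l // inv_eps_le_ratio.
have c0 : 0 <= c3 * y by rewrite mulr_ge0 //; lra.
by apply: le_trans (natceil_le h c0) _; rewrite mulrDl mul1r; lra.
Qed.

Lemma pool_le : (pool_size k tau (eta * k) k + tau + k + zeta + 2)%:R <=
  (c2 * (c1 + 1) * `|alpha| + 2 * c1 + c3 + 7) * y ^+ 6.
Proof.
have y2 := ratio_ge2; have y0 : 0 <= y by lra.
have y1 : 1 <= y by lra.
have H1 := tau_param_le; have H2 := eta_param_le; have H3 := zeta_param_le.
have H4 := k_le_ratio.
have T1 : eta%:R * k%:R <= (c2 * (c1 + 1) * `|alpha| + 1) * y ^+ 6.
  by rewrite (exprSr y 5) [leRHS]mulrA ler_pM.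
have T2 : tau%:R * k%:R * k%:R <= (c1 + 1) * y ^+ 6.
  apply: le_trans (_ : (c1 + 1) * y ^+ 3 * y * y <= _).
    by rewrite !ler_pM ?mulr_ge0.
  have -> : (c1 + 1) * y ^+ 3 * y * y = (c1 + 1) * y ^+ 5 by ring.
  by rewrite ler_wpM2l ?ler_weXn2l ?addr_ge0.
have T3 : tau%:R <= (c1 + 1) * y ^+ 6.
  by apply: le_trans H1 _; rewrite ler_wpM2l ?ler_weXn2l ?addr_ge0.
have Y : y <= y ^+ 6 by rewrite -[leLHS]expr1 ler_weXn2l.
have T4 : zeta%:R <= (c3 + 1) * y ^+ 6.
  by apply: le_trans H3 _; rewrite ler_wpM2l ?addr_ge0.
rewrite /pool_size !natrD !natrM.
have -> : k%:R * (tau%:R * k%:R) = tau%:R * k%:R * k%:R :> R by ring.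
lra.
Qed.

End PoolBound.

End ParameterBounds.

(** With y = k/eps, the left side bounds the logarithm of W^k K^(tau k + k + 4) without the power of
    log n, where W is at most y^4 max(1, log n) and K at most e^A y^6. One ln y comes from [T],
    which stands for tau k, and one from ln K, whence the square. *)
Lemma time_exponent_le (R : realType) (k : nat) (eps c A T : R) :
  0 <= c -> 0 <= A -> 0 < eps <= 1 / 2 -> (0 < k)%N ->
  T <= c * (k%:R ^+ 2 / eps ^+ 2 * ln (k%:R / eps)) + k%:R ->
  k%:R * (4 * ln (k%:R / eps)) + (T + k%:R + 4) * (A + 6 * ln (k%:R / eps)) <=
  (8 + (c + 12) * (2 * A + 6)) *
    (k%:R ^+ 2 / eps ^+ 2 * log2 (k%:R ^+ 2 / eps ^+ 2) ^+ 2) * ln 2.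
Proof.
move=> c0 A0 eb k0; have [e0 e1] := andP eb.
have y2 := ratio_ge2 eb k0; have ky := k_le_ratio eb k0.
have k1 : 1 <= k%:R :> R by rewrite ler1n.
rewrite -expr_div_n; move: (k%:R / eps) y2 ky => y y2 ky TT.
have l1 := ln_ge_half y2.
have l2 := ln2_ge R; have l21 : ln 2 <= 1 :> R by have := @ln_le_sub1 R 2; lra.
have -> : log2 (y ^+ 2) = 2 * ln y / ln 2.
  by rewrite /log2 lnXn ?mulr_natl //; lra.
have -> : (8 + (c + 12) * (2 * A + 6)) * (y ^+ 2 * (2 * ln y / ln 2) ^+ 2) * ln 2 =
  (8 + (c + 12) * (2 * A + 6)) * (y ^+ 2 * ln y ^+ 2) * (4 / ln 2).
  by field; lra.
move: TT; move: (ln y) l1 => l l1 TT.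
have l40 : 1 <= 4 / ln 2 :> R by rewrite ler_pdivlMr; lra.
have f4 : 4 <= y ^+ 2 by rewrite expr2; nra.
have kf : k%:R <= y ^+ 2 by apply: le_trans ky _; rewrite expr2; nra.
move: (y ^+ 2) f4 kf TT => f f4 kf TT {ky y2 y}.
have B0 : 0 <= (8 + (c + 12) * (2 * A + 6)) * (f * l ^+ 2).
  by rewrite mulr_ge0 ?addr_ge0 ?mulr_ge0 ?addr_ge0 ?mulr_ge0 //; lra.
apply: le_trans (_ : (8 + (c + 12) * (2 * A + 6)) * (f * l ^+ 2) <= _); last first.
  by rewrite ler_peMr.
have fl : f <= 2 * (f * l) by nra.
have H1 : T + k%:R + 4 <= (c + 12) * (f * l) by nra.
have H2 : A + 6 * l <= (2 * A + 6) * l by nra.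
have H3 : (T + k%:R + 4) * (A + 6 * l) <= (c + 12) * (f * l) * ((2 * A + 6) * l).
  apply: (@le_trans _ _ ((c + 12) * (f * l) * (A + 6 * l))).
    by rewrite ler_wpM2r //; lra.
  by rewrite ler_wpM2l // !mulr_ge0 //; lra.
have H4 : k%:R * (4 * l) <= 8 * (f * l ^+ 2).
  apply: (@le_trans _ _ (f * (4 * l))); first by rewrite ler_wpM2r //; lra.
  rewrite expr2; have : f * l <= 2 * (f * l) * l by nra.
  by lra.
rewrite [leRHS]mulrDl; apply: lerD => //.
by apply: le_trans H3 _; rewrite le_eqVlt; apply/orP; left; apply/eqP; ring.
Qed.

(** [A] is the logarithm of the constant in the pool bound and the only trace of alpha. In [C], 27
    pays for the prefactor and the rest for the exponent, so that one constant serves both. *)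
Lemma time_bound (R : realType) (c1 c2 c3 alpha eps : R) d k (J : instance d k)
    (B : {set bpoint d}) (zero : bool) :
  let tau := tau_param c1 k eps in
  let A := ln (c2 * (c1 + 1) * `|alpha| + 2 * c1 + c3 + 7) in
  let C := 27 + (8 + (c1 + 12) * (2 * A + 6)) in
  let f : R := k%:R ^+ 2 / eps ^+ 2 in
  0 <= c1 -> 0 <= c2 -> 0 <= c3 -> 0 < eps <= 1 / 2 ->
  (0 < k)%N -> (0 < d)%N -> (0 < #|pts J|)%N -> #|B| = k ->
  (total_time J B zero tau (eta_param c2 tau alpha k eps) (zeta_param c3 eps) eps)%:R
  <= C * (#|pts J|%:R * d%:R * Num.max 1 (log2 #|pts J|%:R) ^+ k
          * 2 `^ (C * (f * log2 f ^+ 2))).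
Proof.
move=> tau A C f c10 c20 c30 eb k0 d0 n0 Bk; have [e0 e1] := andP eb.
set eta := eta_param _ _ _ _ _; set zeta := zeta_param _ _.
set K := (pool_size k tau (eta * k) k + tau + k + zeta + 2)%N.
have := total_time_le zero eps Bk k0 d0 n0 (leqnn K).
rewrite -(ler_nat R) => /le_trans; apply.
have y2 := ratio_ge2 eb k0; set y := k%:R / eps in y2.
have y0 : 0 < y by lra.
have Ca7 : 7 <= c2 * (c1 + 1) * `|alpha| + 2 * c1 + c3 + 7.
  by rewrite lerDr !addr_ge0 // !mulr_ge0 // addr_ge0.
have A0 : 0 <= A by rewrite ln_ge0 //; lra.
have l1 := ln_ge_half y2.
set M := Num.max _ _; have M1 : 1 <= M by rewrite le_max lexx.
set n := #|pts J|.
have HW : (zero + (logceil (1 + eps / 2) n).+1)%:R <= expR (4 * ln y) * M.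
  apply: le_trans (weight_count_le zero eb n0) _; rewrite -/n -/M.
  rewrite ler_wpM2r //; first lra.
  have -> : expR (4 * ln y) = y ^+ 4 by rewrite expRM_natl lnK.
  have iy : eps^-1 <= y := inv_eps_le_ratio eb k0.
  (* 6 <= y^3 because y >= 2, and 1/eps <= y. *)
  apply: (@le_trans _ _ (y ^+ 3 * y)); last by rewrite -exprSr.
  apply: ler_pM => //; first by rewrite invr_ge0 ltW.
  by rewrite !exprS expr0; nra.
have HK : K%:R <= expR (A + 6 * ln y).
  rewrite expRD lnK ?posrE; last lra.
  rewrite expRM_natl lnK //.
  exact: (pool_le alpha c10 c20 c30 eb k0).
have C27 : 27 <= C.
  rewrite lerDl addr_ge0 // mulr_ge0 ?addr_ge0 // mulr_ge0 //.
rewrite natrM !natrM !natrX.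
have Hexp : 27 * ((zero + (logceil (1 + eps / 2) n).+1)%:R ^+ k * K%:R ^+ (tau * k + k + 4)) <=
   C * (M ^+ k * 2 `^ (C * (f * log2 f ^+ 2))).
  rewrite ler_pM ?mulr_ge0 ?exprn_ge0 //.
  apply: (@le_trans _ _ ((expR (4 * ln y) * M) ^+ k * expR (A + 6 * ln y) ^+ (tau * k + k + 4))).
    by rewrite ler_pM ?exprn_ge0 // lerXn2r ?nnegrE ?mulr_ge0 ?expR_ge0 //; lra.
  rewrite exprMn mulrAC [M ^+ k * _]mulrC ler_wpM2r ?exprn_ge0 //; first lra.
  rewrite -!expRM_natl -expRD /powR pnatr_eq0 /= ler_expR.
  rewrite !natrD natrM.
  have := time_exponent_le c10 A0 eb k0 (tau_param_k_le c10 eb k0).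
  move/le_trans; apply; rewrite -/f ler_wpM2r //; first by have := ln2_ge R; lra.
  rewrite ler_wpM2r //; last by rewrite lerDr.
  by rewrite mulr_ge0 ?sqr_ge0 // divr_ge0 ?sqr_ge0.
have -> : C * (n%:R * d%:R * M ^+ k * 2 `^ (C * (f * log2 f ^+ 2))) =
  n%:R * d%:R * (C * (M ^+ k * 2 `^ (C * (f * log2 f ^+ 2)))) by ring.
apply: le_trans (ler_wpM2l (_ : 0 <= n%:R * d%:R) Hexp); last by rewrite mulr_ge0.
move: (_ ^+ k) (K%:R ^+ _) (n%:R) (d%:R) => a b u v.
by rewrite le_eqVlt; apply/orP; left; apply/eqP; ring.
Qed.

Theorem theorem3 (R : realType) :
  exists ctau ceta czeta : R,
    [/\ 0 < ctau, 0 < ceta, 0 < czeta,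
        forall (zero : bool) (alpha eps : R) (d k : nat) (J : instance d k)
               (B : {set bpoint d}),
          0 < eps <= 1 / 2 -> (0 < k)%N -> (0 < #|pts J|)%N -> feasible J ->
          approximate_solution alpha k (pts J) B ->
          let A := good_centers ctau ceta czeta zero alpha eps J B in
          always (fun o => exists2 D, o = Some D & satisfies J D) A /\
          (zero \/ optimal_clusters_nonempty J ->
           3 / 4 <=
             prob (fun o => if o is Some D then
                              (Phi (centers D) (pts J))%:R
                                <= (1 + eps) * (OPT J)%:R
                            else false) A)
      & forall alpha : R, exists (C : R) (p : nat),
          forall (zero : bool) (eps : R) (d k : nat) (J : instance d k)
                 (B : {set bpoint d}),
            0 < eps <= 1 / 2 -> (0 < k)%N -> (0 < d)%N -> (0 < #|pts J|)%N ->
            approximate_solution alpha k (pts J) B ->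
            let n := #|pts J| in
            let f : R := k%:R ^+ 2 / eps ^+ 2 in
            (time (good_centers ctau ceta czeta zero alpha eps J B))%:R
              <= C * (n%:R * d%:R * Num.max 1 (log2 n%:R) ^+ k
                      * 2 `^ (C * (f * log2 f ^+ p)))].
Proof.
have zeta_gt0 (eps : R) : 0 < eps <= 1 / 2 -> (0 < zeta_param 1 eps)%N.
  move=> /andP[e0 _]; rewrite -(ltr0n R); apply: lt_le_trans (natceil_ge _).
  by rewrite divr_gt0.
(* The constants are reached through an equation, so that the large numerals stay opaque from here
   on. *)
have [c1 [c1_gt0 c1E]] : exists c : R, 0 < c /\ 2 * 256 * 256 = c.
  exists (2 * 256 * 256); split; last exact: erefl.
  by apply: mulr_gt0 (ltr0Sn _ 255); apply: mulr_gt0 (ltr0Sn _ 1) (ltr0Sn _ 255).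
have [c2 [c2_gt0 c2E]] : exists c : R, 0 < c /\ 128 * 128 = c.
  exists (128 * 128); split; last exact: erefl.
  by apply: mulr_gt0 (ltr0Sn _ 127) (ltr0Sn _ 127).
exists c1, c2, 1; split=> //.
  move=> zero alpha eps d k J B eb k0 n0 fJ Ba /=; split.
    apply: ok_always.
    have [+ _] := triple_GoodCenters zero (tau_param c1 k eps)
      (eta_param c2 (tau_param c1 k eps) alpha k eps) eps
      k0 n0 Ba.1 (zeta_gt0 eps eb).
    by apply: ok_impl => _ [D -> /(_ fJ) DJ]; exists D.
  move=> /(OPT_attained k0 fJ) Hopt.
  apply: (prob_success eb k0 n0 Ba (tau_param_ge c1E eb k0) _ (zeta_gt0 eps eb) Hopt).
  by rewrite c2E; apply: natceil_ge.
move=> alpha.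
set A := ln (c2 * (c1 + 1) * `|alpha| + 2 * c1 + 1 + 7) : R.
exists (27 + (8 + (c1 + 12) * (2 * A + 6))), 2%N.
move=> zero eps d k J B eb k0 d0 n0 Ba /=.
have [_] := triple_GoodCenters zero (tau_param c1 k eps)
  (eta_param c2 (tau_param c1 k eps) alpha k eps) eps
  k0 n0 Ba.1 (zeta_gt0 eps eb).
rewrite -(ler_nat R) => /le_trans; apply.
exact: (time_bound alpha zero (ltW c1_gt0) (ltW c2_gt0) ler01 eb k0 d0 n0 Ba.1).
Qed.
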